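(* For every fixed integer $K\ge1$, every $\varepsilon\in(0,1)$ and every instance of the $K$-parametric maximization of independence systems problem (as defined in the context) with independence system $(E,\mathcal{F})$, $|E|=n$, and rank quotient $q(E,\mathcal{F})$, a $((1+\varepsilon)\cdot q(E,\mathcal{F}))$-approximation set can be computed in time $$\mathcal{O}\left(T_{\mathrm{Greedy}}\cdot\left(\frac1\varepsilon\log\frac1\varepsilon+\frac1\varepsilon\log(nC)\right)^K\right),$$ where $C$ denotes the maximum profit component among all $a_e,b_{k,e}$, and $T_{\mathrm{Greedy}}$ denotes the running time of the greedy algorithm for the non-parametric problem.
   Context: Independence system: a finite set $E=\{1,\dots,n\}$ with a family $\mathcal{F}\subseteq2^E$ such that $\emptyset\in\mathcal{F}$ and every subset of a member of $\mathcal{F}$ is in $\mathcal{F}$; members of $\mathcal{F}$ are called independent sets; assume $\mathcal{F}\neq\{\emptyset\}$. For $F\subseteq E$, the lower rank is $l(F)=\min\{|B|:B\subseteq F,\ B\in\mathcal{F},\ B\cup\{e\}\notin\mathcal{F}\text{ for all }e\in F\setminus B\}$ and the upper rank is $r(F)=\max\{|B|:B\subseteq F,\ B\in\mathcal{F}\}$. The rank quotient is $q(E,\mathcal{F})=\max_{F\subseteq E,\ l(F)\ne0}\frac{r(F)}{l(F)}\ge1$. Instance: an independence system $(E,\mathcal{F})$ and nonnegative integers $a_e,b_{1,e},\dots,b_{K,e}$ for each $e\in E$; for each $k$ some $b_{k,e}$ is nonzero. Let $\lambda^{\min}_k=\max_{e\in E}\left\{-\frac{a_e}{K\,b_{k,e}}:b_{k,e}\ne0\right\}$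 and $\Lambda=\prod_{k=1}^K[\lambda^{\min}_k,\infty)$. Feasible solutions are the independent sets $x\in\mathcal{F}$, and the objective value at $\lambda\in\Lambda$, to be maximized, is $f(x,\lambda)=\sum_{e\in x}\left(a_e+\sum_{k=1}^K\lambda_kb_{k,e}\right)$. A $\beta$-approximation set ($\beta\ge1$) is a finite set $S\subseteq\mathcal{F}$ such that for every $\lambda\in\Lambda$ there is $x\in S$ with $f(x,\lambda)\ge\frac1\beta f(x',\lambda)$ for all $x'\in\mathcal{F}$. The greedy algorithm for fixed $\lambda$ considers the elements in order of nonincreasing value $a_e+\sum_k\lambda_kb_{k,e}$ and adds an element to the current set whenever the result remains independent; it is a known result that its output $x$ satisfies $f(x,\lambda)\ge\frac{1}{q(E,\mathcal{F})}f(x',\lambda)$ for all $x'\in\mathcal{F}$. Conventions: $\log$ is base 2; $K$ is constant, the $\mathcal{O}$-constant may depend on $K$ only, and the bound is understood asymptotically for small $\varepsilon$; $T_{\mathrm{Greedy}}$ is at least linear in the size of $E$. *)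

(* Defs.v *)
From mathcomp Require Import all_boot all_order all_algebra.
From mathcomp Require Import reals constructive_ereal exp.

Set Implicit Arguments.
Unset Strict Implicit.
Unset Printing Implicit Defensive.

Import Order.TTheory GRing.Theory Num.Theory.
Local Open Scope ring_scope.

Record indep_system (n : nat) := IndepSystem {
  indep :> {set {set 'I_n}};
  indep0 : set0 \in indep;
  indepS : forall A B : {set 'I_n}, B \in indep -> A \subset B -> A \in indep;
  indep_nontrivial : indep != [set set0]
}.

Definition maximal_in (n : nat) (F : indep_system n) (A B : {set 'I_n}) : bool :=
  [&& B \subset A, B \in indep F & [forall e in A :\: B, e |: B \notin indep F]].

(* [#|A|] is neutral here: A has a maximal independent subset, and all of them
   have cardinality at most [#|A|]. *)
Definition lower_rank (n : nat) (F : indep_system n) (A : {set 'I_n}) : nat :=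
  \big[minn/#|A|]_(B : {set 'I_n} | maximal_in F A B) #|B|.

Definition upper_rank (n : nat) (F : indep_system n) (A : {set 'I_n}) : nat :=
  \max_(B : {set 'I_n} | (B \subset A) && (B \in indep F)) #|B|.

(* The default value 0 is irrelevant: the quotients are nonnegative, and by
   [indep_nontrivial] some A has nonzero lower rank. *)
Definition rank_quotient (R : realType) (n : nat) (F : indep_system n) : R :=
  \big[Num.max/0]_(A : {set 'I_n} | lower_rank F A != 0%N)
    ((upper_rank F A)%:R / (lower_rank F A)%:R).

Record param_instance (K n : nat) := ParamInstance {
  system : indep_system n;
  acoef : 'I_n -> nat;
  bcoef : 'I_K -> 'I_n -> nat;
  bcoef_neq0 : forall k : 'I_K, exists e : 'I_n, bcoef k e != 0%N
}.

(* Computed in the extended reals, so that the neutral element of the maximum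
   needs no convention; it is finite by [bcoef_neq0]. *)
Definition lambda_min (R : realType) (K n : nat) (I : param_instance K n)
    (k : 'I_K) : \bar R :=
  \big[Order.max/-oo%E]_(e : 'I_n | bcoef I k e != 0%N)
    (- ((acoef I e)%:R / (K%:R * (bcoef I k e)%:R)))%:E.

Definition in_Lambda (R : realType) (K n : nat) (I : param_instance K n)
    (lambda : 'I_K -> R) : Prop :=
  forall k : 'I_K, (lambda_min R I k <= (lambda k)%:E)%E.

Definition value (R : realType) (K n : nat) (I : param_instance K n)
    (lambda : 'I_K -> R) (e : 'I_n) : R :=
  (acoef I e)%:R + \sum_(k < K) lambda k * (bcoef I k e)%:R.

Definition objective (R : realType) (K n : nat) (I : param_instance K n)
    (x : {set 'I_n}) (lambda : 'I_K -> R) : R :=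
  \sum_(e in x) value I lambda e.

Definition approximation_set (R : realType) (K n : nat) (I : param_instance K n)
    (beta : R) (S : seq {set 'I_n}) : Prop :=
  [/\ 1 <= beta,
      {subset S <= indep (system I)}
    & forall lambda : 'I_K -> R, in_Lambda I lambda ->
        exists2 x : {set 'I_n}, x \in S &
          forall x' : {set 'I_n}, x' \in indep (system I) ->
            beta^-1 * objective I x' lambda <= objective I x lambda].

Definition max_component (K n : nat) (I : param_instance K n) : nat :=
  maxn (\max_(e < n) acoef I e) (\max_(k < K) \max_(e < n) bcoef I k e).

(* [greedy_output F w x]: x results from processing the elements in some order
   of nonincreasing weight w; ties may be broken arbitrarily. *)
Definition greedy_output (R : realType) (n : nat) (F : indep_system n)
    (w : 'I_n -> R) (x : {set 'I_n}) : Prop :=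
  exists s : seq 'I_n,
    [/\ perm_eq s (enum 'I_n),
        sorted (fun e f : 'I_n => w f <= w e) s
      & x = foldl (fun B e => if e |: B \in indep F then e |: B else B) set0 s].

(* Time is counted on a random access machine with unit-cost arithmetic, presented as a
  structured language. The memory consists of arrays of natural numbers and arrays of real
  numbers; a program names its arrays by numerals. The natural numbers serve as
  indices and counters (addition and truncated subtraction); on the reals the
  operations are the four field operations and comparison, without rounding.
  Numerical constants in programs are natural numbers. The independence system
  is accessible only through the greedy subroutine. *)

Inductive nexp : Type :=
| NConst of nat
| NGet of nat & nexp
| NAdd of nexp & nexp
| NSub of nexp & nexp.

Inductive rexp : Type :=
| RConst of nat
| RGet of nat & nexp
| RAdd of rexp & rexp
| RSub of rexp & rexp
| RMul of rexp & rexp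
| RDiv of rexp & rexp.

Inductive test : Type :=
| NLe of nexp & nexp
| RLe of rexp & rexp.

(* [NSet a i e] and [RSet a i e] assign e to cell i of array a. [Greedy w x]
   runs the greedy algorithm on the weights in cells 0, ..., n-1 of real array w
   and writes the indicator vector of its output to these cells of nat array x. *)
Inductive cmd : Type :=
| Skip
| NSet of nat & nexp & nexp
| RSet of nat & nexp & rexp
| Seq of cmd & cmd
| If of test & cmd & cmd
| While of test & cmd
| Greedy of nat & nat.

Record state (R : realType) := State {
  nmem : nat -> nat -> nat;
  rmem : nat -> nat -> R
}.

Definition upd (T : Type) (m : nat -> nat -> T) (a i : nat) (v : T) :
    nat -> nat -> T :=
  fun a' i' => if (a' == a) && (i' == i) then v else m a' i'.

Definition write_set (n : nat) (m : nat -> nat -> nat) (a : nat)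
    (x : {set 'I_n}) : nat -> nat -> nat :=
  fun a' i' => if a' == a then
                 if insub i' is Some e then nat_of_bool (e \in x) else m a' i'
               else m a' i'.

Fixpoint neval (R : realType) (s : state R) (u : nexp) : nat :=
  match u with
  | NConst m => m
  | NGet a i => nmem s a (neval s i)
  | NAdd u1 u2 => (neval s u1 + neval s u2)%N
  | NSub u1 u2 => (neval s u1 - neval s u2)%N
  end.

Fixpoint reval (R : realType) (s : state R) (u : rexp) : R :=
  match u with
  | RConst m => m%:R
  | RGet a i => rmem s a (neval s i)
  | RAdd u1 u2 => reval s u1 + reval s u2
  | RSub u1 u2 => reval s u1 - reval s u2
  | RMul u1 u2 => reval s u1 * reval s u2
  | RDiv u1 u2 => reval s u1 / reval s u2
  end.

Definition teval (R : realType) (s : state R) (b : test) : bool :=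
  match b with
  | NLe u1 u2 => (neval s u1 <= neval s u2)%N
  | RLe u1 u2 => reval s u1 <= reval s u2
  end.

(* Evaluating an expression costs one step per node. *)
Fixpoint ncost (u : nexp) : nat :=
  match u with
  | NConst _ => 1
  | NGet _ i => (ncost i).+1
  | NAdd u1 u2 | NSub u1 u2 => (ncost u1 + ncost u2).+1
  end.

Fixpoint rcost (u : rexp) : nat :=
  match u with
  | RConst _ => 1
  | RGet _ i => (ncost i).+1
  | RAdd u1 u2 | RSub u1 u2 | RMul u1 u2 | RDiv u1 u2 =>
      (rcost u1 + rcost u2).+1
  end.

Definition tcost (b : test) : nat :=
  match b with
  | NLe u1 u2 => (ncost u1 + ncost u2).+1
  | RLe u1 u2 => (rcost u1 + rcost u2).+1
  end.

(* [exec greedy TG c s s' t]: started in s, the command c terminates in s' after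
   t steps, where [greedy] is the greedy subroutine and each call to it takes
   TG steps. *)
Inductive exec (R : realType) (n : nat) (greedy : ('I_n -> R) -> {set 'I_n})
    (TG : nat) : cmd -> state R -> state R -> nat -> Prop :=
| exec_skip s :
    exec greedy TG Skip s s 1
| exec_nset a i u s :
    exec greedy TG (NSet a i u) s
      (State (upd (nmem s) a (neval s i) (neval s u)) (rmem s))
      (ncost i + ncost u).+1
| exec_rset a i u s :
    exec greedy TG (RSet a i u) s
      (State (nmem s) (upd (rmem s) a (neval s i) (reval s u)))
      (ncost i + rcost u).+1
| exec_seq c1 c2 s1 s2 s3 t1 t2 :
    exec greedy TG c1 s1 s2 t1 -> exec greedy TG c2 s2 s3 t2 ->
    exec greedy TG (Seq c1 c2) s1 s3 (t1 + t2)
| exec_if b c1 c2 s s' t :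
    exec greedy TG (if teval s b then c1 else c2) s s' t ->
    exec greedy TG (If b c1 c2) s s' (tcost b + t)
| exec_while_stop b c s :
    ~~ teval s b ->
    exec greedy TG (While b c) s s (tcost b)
| exec_while_step b c s1 s2 s3 t1 t2 :
    teval s1 b -> exec greedy TG c s1 s2 t1 ->
    exec greedy TG (While b c) s2 s3 t2 ->
    exec greedy TG (While b c) s1 s3 (tcost b + t1 + t2)
| exec_greedy w x s :
    exec greedy TG (Greedy w x) s
      (State (write_set (nmem s) x (greedy (fun e : 'I_n => rmem s w e)))
             (rmem s))
      TG.

(* Input: n is in cell 0 of nat array 0; real array 0 holds the a_e, real array
   k+1 holds the b_{k,e} (k < K), and epsilon is in cell 0 of real array K+1.
   All other cells are 0. *)
Definition init_state (R : realType) (K n : nat) (I : param_instance K n)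
    (eps : R) : state R :=
  State
    (fun a i => if (a == 0%N) && (i == 0%N) then n else 0%N)
    (fun a i =>
       if a == K.+1 then (if i == 0%N then eps else 0)
       else if insub i is Some e then
         if a is a'.+1 then
           if insub a' is Some k then (bcoef I k e)%:R else 0
         else (acoef I e)%:R
       else 0).

(* Output: the number N of solutions is in cell 0 of nat array 1, and cells
   j*n, ..., j*n + n - 1 of nat array 2 hold the indicator vector of the j-th
   solution (j < N). *)
Definition output (R : realType) (n : nat) (s : state R) : seq {set 'I_n} :=
  [seq [set e : 'I_n | nmem s 2 (j * n + e)%N != 0%N] | j <- iota 0 (nmem s 1 0)].

Definition log2 (R : realType) (x : R) : R := ln x / ln 2.

(* Main.v *)
Require Import Defs.
From mathcomp Require Import all_boot all_order all_algebra.
From mathcomp Require Import reals constructive_ereal exp.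
From mathcomp Require Import zify ring lra.

Set Implicit Arguments.
Unset Strict Implicit.
Unset Printing Implicit Defensive.

Import Order.TTheory GRing.Theory Num.Theory.
Local Open Scope ring_scope.

(** Write [lambda = lambda_min + mu] with [mu >= 0]. All values are then nonnegative
  combinations, with weights [(1, mu_1, ..., mu_K)], of nonnegative components: the values
  [g_0] at [lambda_min] and the [b_k]. A component that does not vanish on all independent
  singletons is at least [1 / (K S^K)] on one of them ([g_0] has a denominator at most
  [K S^K]), where [S] bounds [n], all [b_k] and the sum of all components. Hence, if [W] is
  the largest weight of such a component, raising all weights to at least [W / D] with
  [D = 6 K S^(K+2) / eps] costs only a small fraction of the optimum divided by [q]. Now
  all ratios of weights lie in [[1 / D, D]], and rounding the [mu_k] up to the geometric grid
  [(1 + eps / 2)^i / D] costs a further factor [1 + eps / 2]. The greedy solutions at the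
  grid points therefore form an approximation set, and the grid has [O (log D / eps)]
  points per dimension. *)

(** * The greedy algorithm *)

Lemma bigminn_leq_id (T : Type) (s : seq T) (P : pred T) (F : T -> nat) (m : nat) :
  (\big[minn/m]_(i <- s | P i) F i <= m)%N.
Proof.
elim: s => [|i s IHs]; first by rewrite big_nil.
by rewrite big_cons; case: ifP => // _; rewrite geq_min IHs orbT.
Qed.

Lemma bigminn_leq (T : finType) (P : pred T) (F : T -> nat) (m : nat) (j : T) :
  P j -> (\big[minn/m]_(i | P i) F i <= F j)%N.
Proof.
move=> Pj; elim: (index_enum T) (mem_index_enum j) => // i s IHs.
rewrite inE big_cons => /orP[/eqP <-|/IHs le_s]; first by rewrite Pj geq_minl.
by case: ifP => // _; rewrite geq_min le_s orbT.
Qed.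

(** An element of an independent subset of [A] forms an independent singleton, so [set0] is not
    maximal in [A] and the lower rank is positive. Sets left out of the rank quotient thus satisfy
    the rank inequality trivially. *)
Lemma lower_rank_eq0 (n : nat) (F : indep_system n) (A : {set 'I_n}) :
  lower_rank F A = 0%N -> upper_rank F A = 0%N.
Proof.
move=> l0; apply/eqP; rewrite -leqn0; apply/bigmax_leqP => B /andP[BA FB].
rewrite leqn0; apply: contraTT isT => /= nB0.
have [e eB] : exists e, e \in B by apply/card_gt0P; rewrite lt0n.
suff: (0 < lower_rank F A)%N by rewrite l0.
rewrite /lower_rank; apply: (big_ind (fun m => (0 < m)%N)) => //.
- by apply/card_gt0P; exists e; rewrite (subsetP BA).
- by move=> x y x0 y0; rewrite leq_min x0.
move=> C /and3P[_ _ /forall_inP/(_ e) Cmax].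
rewrite lt0n cards_eq0; apply/negP => /eqP C0; move: Cmax.
rewrite C0 setD0 setU0 (subsetP BA) // => /(_ isT)/negP; apply.
by apply: (indepS FB); rewrite sub1set.
Qed.

Lemma rank_quotientP (R : realType) (n : nat) (F : indep_system n) (A : {set 'I_n}) :
  (upper_rank F A)%:R <= rank_quotient R F * (lower_rank F A)%:R.
Proof.
have [/[dup] l0 /lower_rank_eq0 ->|l0] := eqVneq (lower_rank F A) 0%N.
  by rewrite l0 mulr0.
rewrite -ler_pdivrMr ?ltr0n ?lt0n //.
by rewrite /rank_quotient (le_bigmax_cond _ (fun A => _ / _)).
Qed.

Lemma indep_nontrivial_ex (n : nat) (F : indep_system n) :
  exists e : 'I_n, [set e] \in indep F.
Proof.
have [/existsP //|] := boolP [exists e : 'I_n, [set e] \in indep F].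
rewrite negb_exists => /forallP Fn; have /negP[] := indep_nontrivial F.
apply/eqP/setP => B; rewrite inE; apply/idP/eqP => [FB|->]; last exact: indep0.
apply/eqP; apply: contraT => /set0Pn[e eB]; have /negP[] := Fn e.
by apply: indepS FB _; rewrite sub1set.
Qed.

Lemma rank_quotient_ge1 (R : realType) (n : nat) (F : indep_system n) :
  1 <= rank_quotient R F.
Proof.
have [e Fe] := indep_nontrivial_ex F.
have r1 : (0 < upper_rank F [set e])%N.
  by apply: (bigop.bigmax_sup [set e]); rewrite ?subxx ?cards1.
have l1 : (lower_rank F [set e] <= 1)%N.
  by rewrite -(cards1 e); exact: bigminn_leq_id.
have q0 : 0 <= rank_quotient R F.
  rewrite /rank_quotient; elim/big_ind: _ => // [x y x0 y0|A _].
    by rewrite le_max x0.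
  by rewrite divr_ge0.
apply: (@le_trans _ _ (upper_rank F [set e])%:R); first by rewrite ler1n.
apply: le_trans (rank_quotientP R F [set e]) _.
by apply: ler_piMr; rewrite // lern1.
Qed.

(** A nonzero lower rank is at least 1. The bound lets [D] be chosen from the input data alone,
    without knowing the rank quotient. *)
Lemma rank_quotient_le (R : realType) (n : nat) (F : indep_system n) :
  rank_quotient R F <= n%:R.
Proof.
apply: bigmax_le => // A l0.
rewrite ler_pdivrMr ?ltr0n ?lt0n //.
apply: (@le_trans _ _ n%:R); last by rewrite ler_peMr // ler1n lt0n.
rewrite ler_nat; apply/bigmax_leqP => B _.
by rewrite -[X in (_ <= X)%N]card_ord max_card.
Qed.

Definition greedy_seq (n : nat) (F : indep_system n) (s : seq 'I_n) : {set 'I_n} :=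
  foldl (fun B e => if e |: B \in indep F then e |: B else B) set0 s.

Lemma greedy_seq_rcons (n : nat) (F : indep_system n) s e :
  greedy_seq F (rcons s e) =
  if e |: greedy_seq F s \in indep F then e |: greedy_seq F s else greedy_seq F s.
Proof. by rewrite /greedy_seq foldl_rcons. Qed.

Lemma greedy_seq_sub (n : nat) (F : indep_system n) s :
  {subset greedy_seq F s <= s}.
Proof.
elim/last_ind: s => [|s e IHs] x; first by rewrite inE.
rewrite greedy_seq_rcons mem_rcons inE; case: ifP => _; last by move=> /IHs ->; rewrite orbT.
by rewrite !inE => /orP[->//|/IHs ->]; rewrite orbT.
Qed.

Lemma greedy_seq_indep (n : nat) (F : indep_system n) s :
  greedy_seq F s \in indep F.
Proof.
elim/last_ind: s => [|s e IHs]; first exact: indep0.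
by rewrite greedy_seq_rcons; case: ifP.
Qed.

(** An element rejected at its turn stays rejected: the current set only grows, and independence
    passes to subsets. *)
Lemma greedy_seq_maximal (n : nat) (F : indep_system n) s :
  maximal_in F [set e in s] (greedy_seq F s).
Proof.
apply/and3P; split; last first.
- elim/last_ind: s => [|s e IHs]; apply/forall_inP => x; rewrite !inE //.
  rewrite mem_rcons inE greedy_seq_rcons; case: ifPn => Fe.
    rewrite !inE negb_or -andbA => /and3P[ne ng]; rewrite (negPf ne) /= => xs.
    have /forall_inP/(_ x) := IHs; rewrite !inE ng xs => /(_ isT).
    by apply: contra => /indepS; apply; rewrite setUS // subsetUr.
  have [-> _ //|_ /= /andP[ng xs]] := eqVneq x e.
  by have /forall_inP/(_ x) := IHs; rewrite !inE ng xs => /(_ isT).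
- exact: greedy_seq_indep.
- by apply/subsetP => x /greedy_seq_sub xs; rewrite inE.
Qed.

(** Uniqueness keeps the elements of [s2] out of [s1], so the intersection removes exactly what the
    later steps added. *)
Lemma greedy_seq_prefix (n : nat) (F : indep_system n) s1 s2 :
  uniq (s1 ++ s2) -> greedy_seq F (s1 ++ s2) :&: [set e in s1] = greedy_seq F s1.
Proof.
elim/last_ind: s2 => [_|s2 e IHs].
  rewrite cats0; apply/setIidPl/subsetP => x /greedy_seq_sub xs; by rewrite inE.
rewrite -rcons_cat rcons_uniq mem_cat negb_or => /andP[/andP[es1 _] us].
rewrite greedy_seq_rcons -(IHs us); case: ifP => // _.
apply/setP => x; rewrite !inE; have [->|//] := eqVneq x e.
by rewrite (negPf es1) !andbF.
Qed.

(* Abel summation, with [H] the carried prefix sum. *)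
Lemma abel_sum_ge0 (R : numDomainType) (T : Type) (w h : T -> R) (H : R) (e : T) (s : seq T) :
  (forall f, 0 <= w f) -> path (fun e f => w f <= w e) e s -> 0 <= H ->
  (forall i, 0 <= H + \sum_(f <- take i s) h f) ->
  0 <= H * w e + \sum_(f <- s) h f * w f.
Proof.
move=> w0; elim: s e H => [|f s IHs] e H /=.
  by move=> _ H0 _; rewrite big_nil addr0 mulr_ge0.
move=> /andP[fe ps] H0 Hpre; rewrite big_cons addrA.
have Hf : 0 <= H + h f by have := Hpre 1%N; rewrite /= take0 big_seq1.
apply: le_trans (IHs f (H + h f) ps Hf _) _ => [i|].
  by have := Hpre i.+1; rewrite /= big_cons addrA.
by rewrite lerD2r mulrDl lerD2r ler_wpM2l.
Qed.

Lemma sum_mem_uniq (R : nzSemiRingType) (T : finType) (s : seq T) (x : {set T}) :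
  uniq s -> \sum_(e <- s) (e \in x)%:R = #|x :&: [set e in s]|%:R :> R.
Proof.
move=> us; have -> : #|x :&: [set e in s]| = size [seq e <- s | e \in x].
  rewrite -(card_uniqP (filter_uniq _ us)); apply: eq_card => e.
  by rewrite !inE mem_filter.
rewrite size_filter -sum1_count natr_sum.
by rewrite [RHS]big_mkcond; apply: eq_bigr => e _; case: ifP.
Qed.

Lemma greedy_output_indep (R : realType) (n : nat) (F : indep_system n)
    (w : 'I_n -> R) (x : {set 'I_n}) :
  greedy_output F w x -> x \in indep F.
Proof. by case=> s [_ _ ->]; exact: greedy_seq_indep. Qed.

(** On every prefix of the greedy order, the greedy set is maximal independent, hence has at least
    lower-rank many elements, while [y] has at most upper-rank many. So all prefix sums of [h] are
    nonnegative, and Abel summation against the nonincreasing weights concludes. *)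
Lemma greedy_output_approx (R : realType) (n : nat) (F : indep_system n)
    (w : 'I_n -> R) (x y : {set 'I_n}) :
  (forall e, 0 <= w e) -> greedy_output F w x -> y \in indep F ->
  \sum_(e in y) w e <= rank_quotient R F * \sum_(e in x) w e.
Proof.
move=> w0 [s [ps ss ->]] Fy; rewrite -/(greedy_seq F s).
have us : uniq s by rewrite (perm_uniq ps) enum_uniq.
set q := rank_quotient R F; set g := greedy_seq F s.
pose h e := q * (e \in g)%:R - (e \in y)%:R.
have sumE (z : {set 'I_n}) : \sum_(e in z) w e = \sum_(e <- s) (e \in z)%:R * w e.
  rewrite (perm_big _ ps) big_enum /= big_mkcond /=.
  by apply: eq_bigr => e _; case: ifP; rewrite ?mul1r ?mul0r.
rewrite -subr_ge0 !sumE mulr_sumr -sumrB.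
rewrite (eq_bigr (fun e => h e * w e)); last by move=> e _; rewrite /h; ring.
have pre i : 0 <= \sum_(f <- take i s) h f.
  rewrite sumrB -mulr_sumr !sum_mem_uniq ?take_uniq // subr_ge0.
  set A := [set e in take i s].
  have -> : g :&: A = greedy_seq F (take i s).
    by rewrite -(@greedy_seq_prefix _ _ (take i s) (drop i s)) cat_take_drop.
  apply: (@le_trans _ _ (upper_rank F A)%:R).
    rewrite ler_nat; apply: (bigop.bigmax_sup (y :&: A)) => //.
    by rewrite subsetIr (indepS Fy) // subsetIl.
  apply: le_trans (rank_quotientP R F A) _; apply: ler_wpM2l.
    by rewrite (le_trans _ (rank_quotient_ge1 _ _)).
  by rewrite ler_nat bigminn_leq // greedy_seq_maximal.
clearbody h; case: s ss pre {g ps us sumE} => [_ _|e s ss pre]; first by rewrite big_nil.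
(* The first element also serves as its own predecessor, with carried sum 0. *)
have := @abel_sum_ge0 _ _ w h 0 e (e :: s) w0; rewrite mul0r add0r; apply => //=.
  by rewrite lexx.
by move=> i; rewrite add0r.
Qed.

(** * Rounding the weights *)

(** The least grid point above [t] exceeds it by a factor at most [rho]: its predecessor is below
    [t], or it is [D^-1 <= t] itself. Its index is below [M] because it is at most [rho * D]. *)
Lemma geometric_grid (R : realFieldType) (D rho t : R) (M : nat) :
  1 <= D -> 1 < rho -> rho * D < D^-1 * rho ^+ M -> D^-1 <= t -> t <= D ->
  exists i, [&& (i < M)%N, t <= D^-1 * rho ^+ i & D^-1 * rho ^+ i <= rho * t].
Proof.
move=> D1 rho1 UM tge tle.
have D0 : 0 < D by lra.
have ex : exists i, t <= D^-1 * rho ^+ i.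
  exists M; apply: le_trans tle _; apply: le_trans (ltW UM).
  by rewrite ler_peMl; lra.
case: (ex_minnP ex) => i ti imin; exists i.
have le_rt : D^-1 * rho ^+ i <= rho * t.
  case: i ti imin => [|i] ti imin.
    rewrite expr0 mulr1 (le_trans tge) // ler_peMl //; last lra.
    by rewrite (le_trans _ tge) // invr_ge0 ltW.
  rewrite exprS mulrCA ler_pM2l; last lra.
  by rewrite leNgt; apply/negP => /ltW /imin; rewrite ltnn.
rewrite ti le_rt !andbT -(ltr_eXn2l (x := rho)) //.
have Di : 0 < D^-1 by rewrite invr_gt0.
rewrite -(ltr_pM2l Di); apply: le_lt_trans UM.
by apply: le_trans le_rt _; rewrite ler_pM2l //; lra.
Qed.

(* Weights of the components vanishing on [act] are irrelevant there; raising every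
   other weight to at least [W / D], where [W] is the largest of them, brings all
   ratios of weights into [[1 / D, D]]. *)
Lemma round_weights (R : realFieldType) (K n : nat) (act : pred 'I_n)
    (g : nat -> 'I_n -> R) (w : nat -> R) (D rho : R) (M : nat) :
  (forall i e, 0 <= g i e) -> (forall i, 0 <= w i) ->
  1 <= D -> 1 < rho -> rho * D < D^-1 * rho ^+ M ->
  let v e := \sum_(i < K.+1) w i * g i e in
  (forall e, act e -> v e = 0) \/
  exists (W c : R) (idx : nat -> nat),
    [/\ 0 < W, 0 < c, forall k, (idx k < M)%N,
        exists e i, [/\ (i < K.+1)%N, act e, 0 < g i e & W * g i e <= v e]
      & forall e, act e ->
          let v' := g 0%N e + \sum_(k < K) D^-1 * rho ^+ idx k * g k.+1 e in
          v e <= c * v' <= rho * (v e + W / D * \sum_(i < K.+1) g i e)].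
Proof.
move=> g0 w0 D1 rho1 UM v.
have D0 : 0 < D by lra.
pose active (i : nat) := [exists e, act e && (0 < g i e)].
have inact e (i : nat) : act e -> ~~ active i -> g i e = 0.
  move=> ae; rewrite negb_exists => /forallP/(_ e); rewrite ae /= -leNgt => ge.
  by apply/eqP; rewrite eq_le ge g0.
have [/existsP[i0 ai0]|noact] := boolP [exists i : 'I_K.+1, active i]; last first.
  left=> e ae; apply: big1 => i _; rewrite (inact e) ?mulr0 //.
  by apply: contra noact => ai; apply/existsP; exists i.
have [im aim imP] : exists2 im : 'I_K.+1, active im &
    forall j : 'I_K.+1, active j -> w j <= w im.
  pose P := [pred i : 'I_K.+1 | active i].
  by case: (@arg_maxP _ _ _ i0 P (fun i => w i) ai0) => im; exists im.
have [W0|Wn0] := eqVneq (w im) 0.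
  left=> e ae; apply: big1 => i _.
  have [ai|ni] := boolP (active i); last by rewrite (inact e) ?mulr0.
  have -> : w i = 0 by apply/eqP; rewrite eq_le w0 andbT -W0 imP.
  by rewrite mul0r.
right; set W := w im.
have W0 : 0 < W by rewrite lt_neqAle eq_sym Wn0 w0.
have WD0 : 0 < W / D by rewrite divr_gt0.
have WDW : W / D <= W by rewrite ler_pdivrMr // ler_peMr // ltW.
(* The value [W] on irrelevant indices is a dummy that keeps all of [w'] in the interval from
   [W / D] to [W]. *)
pose w' (i : nat) := if active i && (i < K.+1)%N then Num.max (w i) (W / D) else W.
have w'lo i : W / D <= w' i by rewrite /w'; case: ifP; rewrite ?le_max ?lexx ?orbT.
have w'hi i : w' i <= W.
  rewrite /w'; case: ifP => // /andP[ai iK]; rewrite ge_max WDW andbT.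
  exact: (imP (Ordinal iK)).
(* Grid points have first weight 1, so the raised weights are divided by the first of them. *)
set c := w' 0%N.
have c0 : 0 < c by exact: lt_le_trans (w'lo _).
have H k : exists i, [&& (i < M)%N, w' k.+1 / c <= D^-1 * rho ^+ i
                      & D^-1 * rho ^+ i <= rho * (w' k.+1 / c)].
  apply: geometric_grid => //.
    rewrite ler_pdivlMr //; apply: le_trans (w'lo _).
    by rewrite mulrC ler_pM2r ?invr_gt0 // w'hi. 
  rewrite ler_pdivrMr //; apply: le_trans (w'hi _) _.
  by rewrite mulrC -ler_pdivrMr // w'lo.
pose idx k := xchoose (H k).
have idxP k : [&& (idx k < M)%N, w' k.+1 / c <= D^-1 * rho ^+ idx k
                 & D^-1 * rho ^+ idx k <= rho * (w' k.+1 / c)] := xchooseP (H k).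
exists W, c, idx; split => //.
- by move=> k; case/and3P: (idxP k).
- have /existsP[e /andP[ae ge]] := aim; exists e, im; split=> //.
  rewrite /v (bigD1 im) //= lerDl; apply: sumr_ge0 => i _; exact: mulr_ge0.
move=> e ae /=.
have vw' (i : 'I_K.+1) : w i * g i e <= w' i * g i e.
  have [ai|ni] := boolP (active i); last by rewrite (inact e) ?mulr0.
  by rewrite ler_wpM2r // /w' ai ltn_ord /= le_max lexx.
(* The maximum of two nonnegative numbers is at most their sum. *)
have w'v (i : 'I_K.+1) : w' i * g i e <= (w i + W / D) * g i e.
  have [ai|ni] := boolP (active i); last by rewrite (inact e) ?mulr0.
  by rewrite ler_wpM2r // /w' ai ltn_ord /= ge_max lerDl lerDr ltW //= w0.
have mid1 (k : 'I_K) : w' k.+1 * g k.+1 e <= c * (D^-1 * rho ^+ idx k * g k.+1 e).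
  have /and3P[_ lo _] := idxP k; rewrite mulrA ler_wpM2r //.
  by rewrite mulrC -ler_pdivrMr.
have mid2 (k : 'I_K) : c * (D^-1 * rho ^+ idx k * g k.+1 e) <= rho * (w' k.+1 * g k.+1 e).
  have /and3P[_ _ hi] := idxP k; rewrite !mulrA ler_wpM2r //.
  by rewrite -mulrA mulrC -ler_pdivlMr // -mulrA.
rewrite mulrDr mulr_sumr; apply/andP; split.
  apply: (@le_trans _ _ (\sum_(i < K.+1) w' i * g i e)); first exact: ler_sum.
  by rewrite big_ord_recl lerD2l; apply: ler_sum => k _; rewrite lift0.
apply: (@le_trans _ _ (rho * \sum_(i < K.+1) w' i * g i e)).
  rewrite big_ord_recl /= mulrDr; apply: lerD.
    by apply: ler_peMl; [apply: mulr_ge0 => //; exact: ltW|exact: ltW].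
  by rewrite mulr_sumr; apply: ler_sum => k _; exact: mid2.
rewrite ler_pM2l; last lra.
rewrite /v mulr_sumr -big_split /=; apply: ler_sum => i _.
by rewrite -mulrDl.
Qed.

(** * The parameter domain and the values at its lower corner *)

Definition above_thresholds (R : realType) (K n : nat) (I : param_instance K n)
    (lm : 'I_K -> R) : Prop :=
  forall k e, bcoef I k e != 0%N -> - ((acoef I e)%:R / (K%:R * (bcoef I k e)%:R)) <= lm k.

Lemma in_LambdaP (R : realType) (K n : nat) (I : param_instance K n) (lambda : 'I_K -> R) :
  in_Lambda I lambda <-> above_thresholds I lambda.
Proof.
split=> H k => [e be|].
  have /bigmax_leP[_ /(_ e be)] := H k; by rewrite lee_fin.
apply/bigmax_leP; split=> [|e be]; first exact: leNye.
by rewrite lee_fin H.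
Qed.

Definition is_lambda_min (R : realType) (K n : nat) (I : param_instance K n)
    (lm : 'I_K -> R) : Prop :=
  above_thresholds I lm /\
  forall k, exists2 e, bcoef I k e != 0%N &
    lm k = - ((acoef I e)%:R / (K%:R * (bcoef I k e)%:R)).

(** Each of the [K] parametric terms is at least [- a_e / K], so together they cannot outweigh
    [a_e]. *)
Lemma value_ge0 (R : realType) (K n : nat) (I : param_instance K n) (lambda : 'I_K -> R) e :
  (0 < K)%N -> above_thresholds I lambda -> 0 <= value I lambda e.
Proof.
move=> K0 H; rewrite /value.
have K0' : 0 < K%:R :> R by rewrite ltr0n.
have : \sum_(k < K) - ((acoef I e)%:R / K%:R) <= \sum_(k < K) lambda k * (bcoef I k e)%:R.
  apply: ler_sum => k _; have [->|be] := eqVneq (bcoef I k e) 0%N.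
    by rewrite mulr0 oppr_le0 divr_ge0.
  have b0 : 0 < (bcoef I k e)%:R :> R by rewrite ltr0n lt0n.
  apply: le_trans (ler_wpM2r (ltW b0) (H k e be)).
  by rewrite mulNr lerN2 invfM !mulrA mulfVK ?gt_eqF.
rewrite sumr_const card_ord -[X in X <= _]mulr_natr mulNr mulfVK ?gt_eqF //; lra.
Qed.

(* Clearing the denominators of the [lm k] makes the value an integer. *)
Lemma value_lambda_min_ge (R : realType) (K n : nat) (I : param_instance K n)
    (lm : 'I_K -> R) (S : R) e :
  (0 < K)%N -> is_lambda_min I lm -> (forall k f, (bcoef I k f)%:R <= S) ->
  0 < value I lm e -> 1 <= K%:R * S ^+ K * value I lm e.
Proof.
move=> K0 [_ lmE] bS v0.
have [f be lmf] := fin_all_exists2 lmE.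
(* [f k] attains the [k]-th threshold, so [N] is a common denominator of all [lm k]. *)
pose N : R := K%:R * \prod_(k < K) (bcoef I k (f k))%:R.
have NS : N <= K%:R * S ^+ K.
  rewrite ler_wpM2l // -[K in _ ^+ K]card_ord -prodr_const.
  by apply: ler_prod => k _; rewrite bS ler0n.
have Nint : N * value I lm e \is a Num.int.
  rewrite /value mulrDr rpredD //.
    by rewrite rpredM ?natr_int // rpredM ?natr_int // rpred_prod // => k _; exact: natr_int.
  rewrite mulr_sumr rpred_sum // => k _; rewrite lmf.
  rewrite /N (bigD1 k) //=.
  set P := \prod_(i < _ | _) _.
  have Pint : P \is a Num.int by rewrite rpred_prod // => i _; exact: natr_int.
  have K1 : K%:R != 0 :> R by rewrite pnatr_eq0 -lt0n.
  have b1 : (bcoef I k (f k))%:R != 0 :> R by rewrite pnatr_eq0 be.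
  have -> : K%:R * ((bcoef I k (f k))%:R * P) *
     (- ((acoef I (f k))%:R / (K%:R * (bcoef I k (f k))%:R)) * (bcoef I k e)%:R)
     = - (P * (acoef I (f k))%:R * (bcoef I k e)%:R).
    by field; rewrite K1 b1.
  by rewrite rpredN !rpredM ?natr_int.
have N0 : 0 < N.
  by rewrite mulr_gt0 ?ltr0n // prodr_gt0 // => k _; rewrite ltr0n lt0n be.
apply: le_trans (ler_wpM2r (ltW v0) NS).
have Nv0 : 0 < N * value I lm e by rewrite mulr_gt0.
have /intrP[m mE] := Nint.
by move: Nv0; rewrite mE ltr0z -[1]/(1%:~R) ler_int gtz0_ge1.
Qed.

Lemma value_le_acoef (R : realType) (K n : nat) (I : param_instance K n) (lm : 'I_K -> R) :
  (forall k, lm k <= 0) -> forall e, value I lm e <= (acoef I e)%:R.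
Proof.
move=> lm0 e; rewrite /value gerDl; apply: sumr_le0 => k _.
by rewrite mulr_le0_ge0.
Qed.

Lemma is_lambda_min_le0 (R : realType) (K n : nat) (I : param_instance K n)
    (lm : 'I_K -> R) k : is_lambda_min I lm -> lm k <= 0.
Proof.
by case=> _ /(_ k)[e _ ->]; rewrite oppr_le0 divr_ge0 // mulr_ge0.
Qed.

Lemma value_shift (R : realType) (K n : nat) (I : param_instance K n)
    (lm mu : 'I_K -> R) e :
  value I (fun k => lm k + mu k) e = value I lm e + \sum_(k < K) mu k * (bcoef I k e)%:R.
Proof.
rewrite /value -addrA -big_split /=; congr (_ + _); apply: eq_bigr => k _.
by rewrite mulrDl.
Qed.

(** * The grid points suffice *)

Lemma sum_set_le (R : realDomainType) (T : finType) (A : {set T}) (f : T -> R) :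
  (forall e, 0 <= f e) -> \sum_(e in A) f e <= \sum_e f e.
Proof. by move=> f0; rewrite [leRHS](bigID (mem A)) /= lerDl sumr_ge0. Qed.

(** The additive error [E] is a small multiple of the value [V] of a feasible singleton, which obeys
    the same bound as [Y]. Solving for [E] turns it into a relative error:
    [Y * (1 - th) <= q * rho * X]. *)
Lemma absorb_error (R : realFieldType) (q eps rho X Y V E : R) :
  0 < eps -> eps < 1 -> rho = 1 + eps / 2 -> 0 <= Y ->
  E <= rho * eps / 6 * V -> V <= q * rho * X + E -> Y <= q * rho * X + E ->
  Y <= (1 + eps) * q * X.
Proof.
move=> eps0 eps1 rhoE Y0; set th := rho * eps / 6; set T := q * rho * X => EV VT YT.
(* Since [(1 + eps) * rho <= 3], the loss [(1 + eps) * th] is at most [eps / 2]; this explains the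
   constant 6 in [D]. *)
have th1 : rho <= (1 + eps) * (1 - th).
  rewrite /th rhoE; nra.
have th0 : 0 < th < 1 by rewrite /th rhoE; nra.
have YT' : Y * (1 - th) <= T by nra.
have rho0 : 0 < rho by rewrite rhoE; lra.
rewrite -(ler_pM2l rho0).
have -> : rho * ((1 + eps) * q * X) = (1 + eps) * T by rewrite /T; ring.
apply: (@le_trans _ _ ((1 + eps) * (1 - th) * Y)); first exact: ler_wpM2r.
by rewrite -mulrA ler_wpM2l ?(mulrC _ Y) //; lra.
Qed.

(** With [mu] the rounded parameter, a competitor is worth at most [c] times its value at [mu],
    hence at most [q * c] times the value of the greedy set there. Going back to [lambda] costs the
    factor [rho] and an additive term that [absorb_error] removes. *)
Lemma grid_approx (R : realType) (K n : nat) (I : param_instance K n)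
    (greedy : ('I_n -> R) -> {set 'I_n}) (lm : 'I_K -> R) (S eps : R) (M : nat) :
  (0 < K)%N ->
  (forall lambda : 'I_K -> R, in_Lambda I lambda ->
     greedy_output (system I) (value I lambda) (greedy (value I lambda))) ->
  is_lambda_min I lm ->
  n%:R <= S -> (forall k f, (bcoef I k f)%:R <= S) ->
  \sum_e ((acoef I e)%:R + \sum_k (bcoef I k e)%:R) <= S ->
  0 < eps -> eps < 1 ->
  let D := 6 * K%:R * S ^+ K.+2 / eps in
  let rho := 1 + eps / 2 in
  rho * D < D^-1 * rho ^+ M ->
  forall lambda, in_Lambda I lambda ->
  exists2 idx : nat -> nat, (forall k, (idx k < M)%N) &
    let x := greedy (value I (fun k : 'I_K => lm k + D^-1 * rho ^+ idx k)) in
    forall x', x' \in indep (system I) ->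
      ((1 + eps) * rank_quotient R (system I))^-1 * objective I x' lambda <= objective I x lambda.
Proof.
move=> K0 grP lmP nS bS sS eps0 eps1 D rho UM lambda /in_LambdaP lamP.
have [lm_above lmE] := lmP.
have [e0 _] := indep_nontrivial_ex (system I).
have n1 : 1 <= n%:R :> R by rewrite ler1n (leq_trans _ (ltn_ord e0)).
have S1 : 1 <= S by lra.
have KR1 : 1 <= K%:R :> R by rewrite ler1n.
have SK1 : 1 <= S ^+ K.+2 by rewrite exprn_ege1.
have D1 : 1 <= D.
  rewrite ler_pdivlMr // mul1r; apply: (@le_trans _ _ (6 * K%:R)); first lra.
  by rewrite ler_peMr //; lra.
have D0 : 0 < D by lra.
have rhoE : rho = 1 + eps / 2 by [].
clearbody rho.
have rho1 : 1 < rho by lra.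
have rho0 : 0 < rho by lra.
have S0 : 0 < S by lra.
have KR0 : 0 < K%:R :> R by lra.
(* Index 0 carries the values at [lm] with weight 1, index [k + 1] the component [b_k]; indices
   beyond [K] get the default 0. *)
pose g (i : nat) e : R := if i is k.+1 then
  if insub k is Some k' then (bcoef I k' e)%:R else 0 else value I lm e.
pose w (i : nat) : R := if i is k.+1 then
  if insub k is Some k' then lambda k' - lm k' else 0 else 1.
have gS (k : 'I_K) e : g k.+1 e = (bcoef I k e)%:R by rewrite /g valK.
have wS (k : 'I_K) : w k.+1 = lambda k - lm k by rewrite /w valK.
have lm_le k : lm k <= lambda k by have [e be ->] := lmE k; exact: lamP.
have g0 i e : 0 <= g i e.
  case: i => [|k]; rewrite /g; first exact: value_ge0.
  by case: insub => // k'.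
have w0 i : 0 <= w i.
  case: i => [|k]; rewrite /w //; case: insub => // k'; by rewrite subr_ge0.
have vE e : \sum_(i < K.+1) w i * g i e = value I lambda e.
  have -> : value I lambda e = value I (fun k => lm k + (lambda k - lm k)) e.
    by congr (value I _ e); apply: boolp.funext => k; rewrite addrC subrK.
  rewrite big_ord_recl /= mul1r value_shift; congr (_ + _); apply: eq_bigr => k _.
  by rewrite -wS -gS.
have v'E (t : nat -> R) e : g 0%N e + \sum_(k < K) t k * g k.+1 e =
    value I (fun k : 'I_K => lm k + t k) e.
  by rewrite value_shift; congr (_ + _); apply: eq_bigr => k _; rewrite gS.
have t_in (idx : nat -> nat) : in_Lambda I (fun k : 'I_K => lm k + D^-1 * rho ^+ idx k).
  apply/in_LambdaP => k e be; apply: le_trans (lm_above k e be) _.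
  by rewrite lerDl mulr_ge0 ?invr_ge0 ?exprn_ge0 //; lra.
have act_in x : x \in indep (system I) -> forall e, e \in x -> [set e] \in indep (system I).
  by move=> Fx e ex; apply: indepS Fx _; rewrite sub1set.
have q1 := rank_quotient_ge1 R (system I).
have qn := rank_quotient_le R (system I).
set q := rank_quotient R (system I) in q1 qn *.
have eq0 : 0 < (1 + eps) * q by rewrite mulr_gt0 //; lra.
case: (@round_weights _ K n (fun e => [set e] \in indep (system I)) g w D rho M) => //.
  (* Degenerate case: every feasible solution has objective 0, so any grid point works; the grid is
     nonempty because [D^-1 <= rho * D]. *)
  move=> v0; exists (fun=> 0%N) => [k|/= x' Fx'].
    rewrite lt0n; apply/eqP => M0; move: UM; rewrite M0 expr0 mulr1.
    rewrite -(ltr_pM2l D0) mulfV ?gt_eqF //; nra.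
  have obj0 x : x \in indep (system I) -> objective I x lambda = 0.
    by move=> Fx; apply: big1 => e ex; rewrite -vE v0 //; exact: act_in ex.
  rewrite !obj0 ?mulr0 //; apply: greedy_output_indep; exact: (grP _ (t_in (fun=> 0%N))).
move=> [W [c [idx [W0 c0 idxM [es [is_ [isK aes ges Wes]]] vv']]]].
exists idx => //=; set mu := fun k : 'I_K => lm k + _.
set x := greedy _ => x' Fx'.
have grx : greedy_output (system I) (value I mu) x by apply: grP; exact: t_in.
have Fx := greedy_output_indep grx.
rewrite mulrC ler_pdivrMr // mulrC.
have sumgS : \sum_(e in x) \sum_(i < K.+1) g i e <= S.
  apply: le_trans _ sS; apply: (@le_trans _ _ (\sum_e \sum_(i < K.+1) g i e)).
    by apply: sum_set_le => e; apply: sumr_ge0.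
  apply: ler_sum => e _; rewrite big_ord_recl /= lerD //.
    by apply: value_le_acoef => k; exact: is_lambda_min_le0 lmP.
  by apply: ler_sum => k _; rewrite -gS.
have mu_ge0 e : 0 <= value I mu e by apply: value_ge0 => //; apply/in_LambdaP/t_in.
have muE e : g 0%N e + \sum_(k < K) D^-1 * rho ^+ idx k * g k.+1 e = value I mu e.
  exact: (v'E (fun k => D^-1 * rho ^+ idx k)).
have lo e : [set e] \in indep (system I) -> value I lambda e <= c * value I mu e.
  by move=> ae; have /andP[] := vv' e ae; rewrite muE vE.
have hi e : [set e] \in indep (system I) ->
    c * value I mu e <= rho * (value I lambda e + W / D * \sum_(i < K.+1) g i e).
  by move=> ae; have /andP[] := vv' e ae; rewrite muE vE.
have main z : z \in indep (system I) ->
    objective I z lambda <= q * rho * objective I x lambda + q * rho * (W / D * S).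
  move=> Fz; apply: (@le_trans _ _ (c * \sum_(e in z) value I mu e)).
    by rewrite mulr_sumr; apply: ler_sum => e ez; apply: lo; exact: act_in ez.
  apply: (@le_trans _ _ (q * (c * \sum_(e in x) value I mu e))).
    rewrite mulrCA ler_pM2l //; exact: greedy_output_approx.
  rewrite -mulrDr -mulrA ler_pM2l; last exact: lt_le_trans ltr01 q1.
  apply: (@le_trans _ _
      (rho * (objective I x lambda + W / D * \sum_(e in x) \sum_(i < K.+1) g i e))).
    rewrite /objective !mulr_sumr -big_split mulr_sumr /=; apply: ler_sum => e ez; apply: hi.
    exact: act_in ez.
  by rewrite ler_pM2l // lerD2l ler_pM2l // divr_gt0.
have vge0 e : 0 <= value I lambda e by exact: value_ge0.
apply: (@absorb_error _ q eps rho _ _ (value I lambda es) (q * rho * (W / D * S))) => //.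
- by apply: sumr_ge0.
(* The selected component is at least [1 / (K S^K)] at [es]: by [value_lambda_min_ge] for index 0,
   as a positive integer otherwise. *)
- have WV : W <= K%:R * S ^+ K * value I lambda es.
    rewrite -vE; apply: (@le_trans _ _ (K%:R * S ^+ K * (W * g is_ es))); last first.
      by rewrite ler_pM2l // mulr_gt0 ?exprn_gt0.
    rewrite mulrCA ler_peMr ?(ltW W0) //; case: is_ isK ges {Wes} => [|k].
      move=> _ ges; exact: (value_lambda_min_ge K0 lmP bS ges).
    rewrite ltnS => kK; rewrite (gS (Ordinal kK)) ltr0n => b0.
    by rewrite !mulr_ege1 ?exprn_ege1 ?ler1n.
  (* The two powers of [S] in [D] beyond [S ^+ K] pay for the sum of the components and for
     [q <= n <= S]. *)
  have -> : q * rho * (W / D * S) = rho * eps / 6 * (q * S * W / (K%:R * S ^+ K.+2)).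
    rewrite /D; field; rewrite !expf_neq0 ?gt_eqF //; lra.
  have re0 : 0 < rho * eps / 6 by rewrite divr_gt0 // mulr_gt0.
  rewrite ler_pM2l // ler_pdivrMr; last by rewrite mulr_gt0 ?exprn_gt0.
  apply: (@le_trans _ _ (S * S * (K%:R * S ^+ K * value I lambda es))).
    have q0 : 0 <= q by lra.
    have qS : q * S <= S * S by rewrite ler_pM2r //; exact: le_trans nS.
    by rewrite ler_pM // ?mulr_ge0 ?(ltW W0) ?(ltW S0).
  by rewrite !exprS le_eqVlt; apply/orP; left; apply/eqP; ring.
- apply: le_trans _ (main _ aes); by rewrite /objective big_set1.
- exact: main.
Qed.

(** * The program *)

(* Memory layout: real arrays [0, ..., K+1] (input), [K+2] (cells 0, 1, 2: [S], [D],
  [1 + eps / 2]), [K+3] ([lambda_min]), [K+4] (the current grid point) and [K+5] (weights), and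
  nat arrays 1, 2 (output), 3 (greedy output), 4 (loop counter) and 5 (the number of solutions
  found times [n]). *)

Definition counter : nexp := NGet 4 (NConst 0).
Definition ground_size : nexp := NGet 0 (NConst 0).

(** One counter cell serves all these loops, since they are never nested. *)
Definition for_each (body : cmd) : cmd :=
  Seq (NSet 4 (NConst 0) (NConst 0))
      (While (NLe (NAdd counter (NConst 1)) ground_size)
             (Seq body (NSet 4 (NConst 0) (NAdd counter (NConst 1))))).

(** Array names are numerals, so ranging over [k] is unrolled into an expression whose size depends
    on [K] only. The extra 1 per element makes the total at least [n] and strictly larger than every
    [a_e]. *)
Fixpoint component_sum_exp (m : nat) : rexp :=
  if m is m'.+1 then RAdd (component_sum_exp m') (RGet m'.+1 counter)
  else RAdd (RConst 1) (RGet 0 counter).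

Definition scalar_exp (K j : nat) : rexp := RGet K.+2 (NConst j).

Fixpoint power_exp (x : rexp) (m : nat) : rexp :=
  if m is m'.+1 then RMul x (power_exp x m') else RConst 1.

Definition total_cmd (K : nat) : cmd :=
  for_each (RSet K.+2 (NConst 0) (RAdd (scalar_exp K 0) (component_sum_exp K))).

Definition scalars_cmd (K : nat) : cmd :=
  Seq (RSet K.+2 (NConst 1)
         (RDiv (RMul (RMul (RConst 6) (RConst K)) (power_exp (scalar_exp K 0) K.+2))
               (RGet K.+1 (NConst 0))))
      (RSet K.+2 (NConst 2)
         (RAdd (RConst 1) (RDiv (RGet K.+1 (NConst 0)) (RConst 2)))).

Definition threshold_exp (K k : nat) : rexp :=
  RSub (RConst 0) (RDiv (RGet 0 counter) (RMul (RConst K) (RGet k.+1 counter))).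

Definition lambda_min_step (K k : nat) : cmd :=
  If (RLe (RGet k.+1 counter) (RConst 0)) Skip
     (If (RLe (threshold_exp K k) (RGet K.+3 (NConst k))) Skip
         (RSet K.+3 (NConst k) (threshold_exp K k))).

(* [- S] lies below all thresholds. *)
Fixpoint lambda_min_cmd (K m : nat) : cmd :=
  if m is k.+1 then
    Seq (lambda_min_cmd K k)
        (Seq (RSet K.+3 (NConst k) (RSub (RConst 0) (scalar_exp K 0)))
             (for_each (lambda_min_step K k)))
  else Skip.

Fixpoint value_exp (K m : nat) : rexp :=
  if m is k.+1 then
    RAdd (value_exp K k)
         (RMul (RAdd (RGet K.+3 (NConst k)) (RGet K.+4 (NConst k))) (RGet k.+1 counter))
  else RGet 0 counter.

(** Natural numbers cannot be multiplied in programs, so the offset of the next output block is kept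
    as a running sum in array 5. *)
Definition solve_cmd (K : nat) : cmd :=
  Seq (for_each (RSet K.+4.+1 counter (value_exp K K)))
      (Seq (Greedy K.+4.+1 3)
           (Seq (for_each (NSet 2 (NAdd (NGet 5 (NConst 0)) counter) (NGet 3 counter)))
                (Seq (NSet 5 (NConst 0) (NAdd (NGet 5 (NConst 0)) ground_size))
                     (NSet 1 (NConst 0) (NAdd (NGet 1 (NConst 0)) (NConst 1)))))).

(** One nested loop per coordinate. Comparing the current coordinate with [rho * D] ends a loop, so
    neither a logarithm nor the number of grid points has to be computed. *)
Fixpoint grid_cmd (K m : nat) : cmd :=
  if m is k.+1 then
    Seq (RSet K.+4 (NConst k) (RDiv (RConst 1) (scalar_exp K 1)))
        (While (RLe (RGet K.+4 (NConst k)) (RMul (scalar_exp K 2) (scalar_exp K 1)))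
               (Seq (grid_cmd K k)
                    (RSet K.+4 (NConst k) (RMul (RGet K.+4 (NConst k)) (scalar_exp K 2)))))
  else solve_cmd K.

Definition approx_cmd (K : nat) : cmd :=
  Seq (total_cmd K) (Seq (scalars_cmd K) (Seq (lambda_min_cmd K K) (grid_cmd K K))).

(** * A program logic for total correctness with time bounds *)

Section Runs.
Variables (R : realType) (n : nat) (greedy : ('I_n -> R) -> {set 'I_n}) (TG : nat).
Implicit Types (s : state R) (Q : state R -> Prop).

Definition runs (c : cmd) s (T : nat) Q : Prop :=
  exists s' t, [/\ exec greedy TG c s s' t, (t <= T)%N & Q s'].

Lemma runs_weaken c s T T' Q Q' :
  runs c s T Q -> (T <= T')%N -> (forall s', Q s' -> Q' s') -> runs c s T' Q'.
Proof.
move=> [s' [t [e tT q]]] TT QQ; exists s', t; split=> //; last exact: QQ.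
exact: leq_trans TT.
Qed.

Lemma runs_skip s T Q : (0 < T)%N -> Q s -> runs Skip s T Q.
Proof. by move=> T0 q; exists s, 1%N; split=> //; exact: exec_skip. Qed.

Lemma runs_nset a i u s Q :
  Q (State (upd (nmem s) a (neval s i) (neval s u)) (rmem s)) ->
  runs (NSet a i u) s (ncost i + ncost u).+1 Q.
Proof. by move=> q; eexists; eexists; split; [exact: exec_nset|exact: leqnn|]. Qed.

Lemma runs_rset a i u s Q :
  Q (State (nmem s) (upd (rmem s) a (neval s i) (reval s u))) ->
  runs (RSet a i u) s (ncost i + rcost u).+1 Q.
Proof. by move=> q; eexists; eexists; split; [exact: exec_rset|exact: leqnn|]. Qed.

Lemma runs_greedy w x s Q :
  Q (State (write_set (nmem s) x (greedy (fun e : 'I_n => rmem s w e))) (rmem s)) ->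
  runs (Greedy w x) s TG Q.
Proof. by move=> q; eexists; eexists; split; [exact: exec_greedy|exact: leqnn|]. Qed.

Lemma runs_seq c1 c2 s T1 T2 Q :
  runs c1 s T1 (fun s' => runs c2 s' T2 Q) -> runs (Seq c1 c2) s (T1 + T2) Q.
Proof.
move=> [s1 [t1 [e1 l1 [s2 [t2 [e2 l2 q]]]]]]; exists s2, (t1 + t2)%N; split=> //.
  exact: exec_seq e1 e2.
exact: leq_add.
Qed.

Lemma runs_if b c1 c2 s T Q :
  runs (if teval s b then c1 else c2) s T Q -> runs (If b c1 c2) s (tcost b + T) Q.
Proof.
move=> [s' [t [e l q]]]; exists s', (tcost b + t)%N; split=> //; first exact: exec_if.
by rewrite leq_add2l.
Qed.

(** The invariant is indexed by the number of completed iterations and decides the test; the proof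
    is by induction on the iterations that remain. *)
Lemma runs_while b c (N T : nat) (J : nat -> state R -> Prop) s :
  (forall i s, (i < N)%N -> J i s -> teval s b /\ runs c s T (J i.+1)) ->
  (forall s, J N s -> ~~ teval s b) ->
  J 0%N s -> runs (While b c) s (N * (tcost b + T) + tcost b) (J N).
Proof.
move=> Hstep Hstop.
suff H j i s1 : (i + j = N)%N -> J i s1 ->
    runs (While b c) s1 (j * (tcost b + T) + tcost b) (J N).
  exact: H.
elim: j i s1 => [|j IHj] i s1.
  rewrite addn0 => -> Js; exists s1, (tcost b); split=> //.
  exact: exec_while_stop (Hstop _ Js).
move=> ijN Js; have [] := Hstep i s1 _ Js; first by lia.
move=> tb [s2 [t2 [e2 l2 J2]]].
have [|s3 [t3 [e3 l3 J3]]] := IHj i.+1 s2 _ J2; first by lia.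
exists s3, (tcost b + t2 + t3)%N; split=> //; first exact: exec_while_step e3.
by rewrite mulSn -!addnA leq_add2l leq_add // addnC.
Qed.

Lemma runs_for_each body (N T : nat) (J : nat -> state R -> Prop) s :
  (forall i s v, J i s -> J i (State (upd (nmem s) 4 0 v) (rmem s))) ->
  (forall i s, J i s -> nmem s 0 0 = N) ->
  (forall i s, (i < N)%N -> J i s -> nmem s 4 0 = i ->
     runs body s T (fun s' => J i.+1 s' /\ nmem s' 4 0 = i)) ->
  J 0%N s -> runs (for_each body) s (N * (T + 13) + 10) (J N).
Proof.
move=> Jctr Jsize Hbody J0.
(* Initializing the counter costs 3, each test 7 and each increment 6. *)
apply: (@runs_weaken _ _ (3 + (N * (7 + (T + 6)) + 7)) _
  (fun s' => J N s' /\ nmem s' 4 0 = N)); last by move=> s' [].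
- apply/runs_seq/runs_nset.
  apply: (@runs_while _ _ N (T + 6) (fun i s' => J i s' /\ nmem s' 4 0 = i)).
  + move=> i s1 iN [Ji ci]; split; first by rewrite /= ci (Jsize _ _ Ji) addn1.
    apply: runs_seq; apply: runs_weaken (Hbody _ _ iN Ji ci) (leqnn _) _ => s2 [Ji1 c2].
    apply: runs_nset => /=; split; first exact: Jctr.
    by rewrite /upd /= c2 addn1.
  + by move=> s1 [JN cN]; rewrite /= cN (Jsize _ _ JN) addn1 ltnn.
  + by split; [exact: Jctr|].
- by rewrite !addnA; lia.
Qed.

(** Input, scalars, [lambda_min], grid point and weights occupy real arrays in this order, so what a
    stage preserves is mostly an initial segment of the arrays. *)
Definition frame (b : nat) (m m' : nat -> nat -> R) : Prop :=
  forall a i, (a <= b)%N -> m' a i = m a i.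

Definition counter_frame (m m' : nat -> nat -> nat) : Prop :=
  forall a i, a != 4%N -> m' a i = m a i.

Lemma upd_same (T : Type) (m : nat -> nat -> T) a i v : upd m a i v a i = v.
Proof. by rewrite /upd !eqxx. Qed.

Lemma upd_array (T : Type) (m : nat -> nat -> T) a i v a' i' :
  a' != a -> upd m a i v a' i' = m a' i'.
Proof. by rewrite /upd => /negPf ->. Qed.

Lemma upd_cell (T : Type) (m : nat -> nat -> T) a i v a' i' :
  i' != i -> upd m a i v a' i' = m a' i'.
Proof. by rewrite /upd => /negPf ->; rewrite andbF. Qed.

Lemma frame_upd b m m' a i v : (b < a)%N -> frame b m m' -> frame b m (upd m' a i v).
Proof. by move=> ba fr a' i' a'b; rewrite upd_array ?fr //; lia. Qed.

Lemma frame_trans b b' m1 m2 m3 :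
  (b <= b')%N -> frame b m1 m2 -> frame b' m2 m3 -> frame b m1 m3.
Proof. by move=> bb f12 f23 a i ab; rewrite f23 ?f12 //; lia. Qed.

Lemma counter_frame_upd m m' i v : counter_frame m m' -> counter_frame m (upd m' 4 i v).
Proof. by move=> fr a j a4; rewrite upd_array ?fr. Qed.

Lemma reval_component_sum s m :
  reval s (component_sum_exp m) =
  1 + rmem s 0 (nmem s 4 0) + \sum_(k < m) rmem s k.+1 (nmem s 4 0).
Proof.
elim: m => [|m IHm]; first by rewrite big_ord0 addr0.
by rewrite /= IHm big_ord_recr /= addrA.
Qed.

Lemma reval_power s x m : reval s (power_exp x m) = reval s x ^+ m.
Proof. by elim: m => [|m IHm]; rewrite ?expr0 // exprS -IHm. Qed.

Lemma reval_value K s m :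
  reval s (value_exp K m) = rmem s 0 (nmem s 4 0) +
    \sum_(k < m) (rmem s K.+3 k + rmem s K.+4 k) * rmem s k.+1 (nmem s 4 0).
Proof.
elim: m => [|m IHm]; first by rewrite big_ord0 addr0.
by rewrite /= IHm big_ord_recr /= addrA.
Qed.

(** * Computing the scalars and [lambda_min] *)

Definition total_time (K N : nat) : nat :=
  (N * ((rcost (component_sum_exp K) + 5) + 13) + 10)%N.

Lemma runs_total K N s :
  nmem s 0 0 = N -> rmem s K.+2 0%N = 0 ->
  runs (total_cmd K) s (total_time K N) (fun s' =>
    [/\ frame K.+1 (rmem s) (rmem s'), counter_frame (nmem s) (nmem s')
      & rmem s' K.+2 0%N =
        \sum_(e < N) (1 + rmem s 0 e + \sum_(k < K) rmem s k.+1 e)]).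
Proof.
move=> sN s0.
apply: (runs_for_each (J := fun i s' => [/\ frame K.+1 (rmem s) (rmem s'),
    counter_frame (nmem s) (nmem s')
    & rmem s' K.+2 0%N = \sum_(e < i) (1 + rmem s 0 e + \sum_(k < K) rmem s k.+1 e)])).
- by move=> i s' v [f1 f2 f3]; split=> //; exact: counter_frame_upd.
- by move=> i s' [_ f2 _]; rewrite f2.
- move=> i s' iN [f1 f2 f3] ci.
  apply: (@runs_weaken _ _ _ _ _ (fun s2 => _)); last by move=> s2; apply.
    apply: runs_rset => /=; split=> //; split=> //; first exact: frame_upd.
    rewrite upd_same f3 big_ord_recr /= reval_component_sum ci f1 //; congr (_ + (_ + _)).
    by apply: eq_bigr => k _; rewrite f1 // ltnS ltnW.
  by rewrite /=; lia.
- by split=> //; rewrite big_ord0.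
Qed.

Lemma runs_scalars K s :
  runs (scalars_cmd K) s (rcost (power_exp (scalar_exp K 0) K.+2) + 30) (fun s' =>
    let D := 6 * K%:R * rmem s K.+2 0%N ^+ K.+2 / rmem s K.+1 0%N in
    let rho := 1 + rmem s K.+1 0%N / 2 in
    [/\ frame K.+1 (rmem s) (rmem s'), nmem s' = nmem s, rmem s' K.+2 0%N = rmem s K.+2 0%N,
        rmem s' K.+2 1%N = D & rmem s' K.+2 2 = rho]).
Proof.
apply: (@runs_weaken _ _ _ _ _ (fun s2 => _)); last by move=> s2; apply.
  apply/runs_seq/runs_rset/runs_rset; split=> //.
  - by do 2!apply: frame_upd => //.
  - by rewrite /= !upd_cell.
  - by rewrite /= upd_cell // upd_same reval_power /= !exprS.
  - by rewrite /= upd_same upd_array //; lia.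
rewrite /=; lia.
Qed.

Definition threshold (m : nat -> nat -> R) (K k e : nat) : R := - (m 0%N e / (K%:R * m k.+1 e)).

(** The loop invariant after [N] elements. The alternative [- S] is the start value, which remains
    until an element with nonzero [b_k] is met. *)
Definition is_max_threshold (m : nat -> nat -> R) (K k N : nat) (S v : R) : Prop :=
  (forall e, (e < N)%N -> 0 < m k.+1 e -> threshold m K k e <= v) /\
  (v = - S \/ exists e, [/\ (e < N)%N, 0 < m k.+1 e & v = threshold m K k e]).

Definition lambda_min_time (N m : nat) : nat := (m * (N * 50 + 16) + 1)%N.

Lemma runs_lambda_min K N m s :
  (m <= K)%N -> nmem s 0 0 = N ->
  runs (lambda_min_cmd K m) s (lambda_min_time N m) (fun s' =>
    [/\ frame K.+2 (rmem s) (rmem s'), counter_frame (nmem s) (nmem s')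
      & forall k, (k < m)%N ->
          is_max_threshold (rmem s) K k N (rmem s K.+2 0%N) (rmem s' K.+3 k)]).
Proof.
move=> mK sN; elim: m mK => [|k IHk] kK; first by apply: runs_skip => //; rewrite /lambda_min_time; lia.
apply: (@runs_weaken _ _ (lambda_min_time N k + (6 + (N * (37 + 13) + 10))) _
  (fun s2 => _)); last by move=> s2; apply.
  apply: runs_seq; apply: runs_weaken (IHk (ltnW kK)) (leqnn _) _ => s1 [f1 f2 f3].
  apply/runs_seq/runs_rset; rewrite /= f1 //.
  pose J i s' := [/\ frame K.+2 (rmem s) (rmem s'), counter_frame (nmem s) (nmem s'),
    forall k', (k' < k)%N -> is_max_threshold (rmem s) K k' N (rmem s K.+2 0%N) (rmem s' K.+3 k')
    & is_max_threshold (rmem s) K k i (rmem s K.+2 0%N) (rmem s' K.+3 k)].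
  apply: (@runs_weaken _ _ (N * (37 + 13) + 10) _ (J N)) => //; last first.
    move=> s' [g1 g2 g3 g4]; split=> // k'; rewrite ltnS leq_eqVlt => /orP[/eqP ->//|].
    exact: g3.
  apply: (runs_for_each (J := J)).
  - by move=> i s' v [g1 g2 g3 g4]; split=> //; exact: counter_frame_upd.
  - by move=> i s' [_ g2 _ _]; rewrite g2.
  - move=> i s' iN [g1 g2 g3 [g4 g5]] ci.
    have thresholdE : reval s' (threshold_exp K k) = threshold (rmem s) K k i.
      by rewrite /= ci !g1 ?sub0r //; lia.
    have bE : rmem s' k.+1 i = rmem s k.+1 i by rewrite g1 //; lia.
    (* Covers both ways of leaving the cell unchanged; for a vanishing coefficient the premise is
       vacuous. *)
    have skip_ok : (0 < rmem s k.+1 i -> threshold (rmem s) K k i <= rmem s' K.+3 k) ->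
        J i.+1 s' /\ nmem s' 4 0 = i.
      move=> le_i; split=> //; split=> //; split.
        by move=> e; rewrite ltnS leq_eqVlt => /orP[/eqP ->//|]; exact: g4.
      by case: g5 => [|[e [ei e0 eE]]]; [left|right; exists e; split=> //; exact: ltnW].
    apply: (@runs_weaken _ _ (5 + (14 + 13)) _
      (fun s2 => J i.+1 s2 /\ nmem s2 4 0 = i)) => //.
    apply: (@runs_if (RLe (RGet k.+1 counter) (RConst 0))).
    rewrite /teval -/(reval _) /= ci bE; case: ifPn => [b0|]; last rewrite -ltNge => b0.
      by apply: runs_skip => //; apply: skip_ok; lra.
    apply: (@runs_if (RLe (threshold_exp K k) (RGet K.+3 (NConst k)))).
    rewrite /teval thresholdE /=; case: ifPn => [le_p|]; last rewrite -ltNge => lt_p.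
      by apply: runs_skip => //; exact: skip_ok.
    apply: runs_rset; rewrite thresholdE /=; split=> //; split=> //.
    + exact: frame_upd.
    + by move=> k' k'k; rewrite /= upd_cell; [exact: g3|lia].
    + rewrite /= upd_same; split; last by right; exists i.
      move=> e; rewrite ltnS leq_eqVlt => /orP[/eqP ->//|ei e0].
      by apply: le_trans (ltW lt_p); exact: g4.
  - split=> //=.
    + exact: frame_upd.
    + by move=> k' k'k; rewrite /= upd_cell; [exact: f3|lia].
    + by rewrite /= upd_same sub0r; split=> //; left.
rewrite /lambda_min_time; lia.
Qed.

(** * Solving at a grid point and traversing the grid *)

Definition solution (K : nat) (m : nat -> nat -> R) (r : nat -> R) : {set 'I_n} :=
  greedy (fun e : 'I_n => m 0%N e + \sum_(k < K) (m K.+3 k + r k) * m k.+1 e).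

Definition stored (L : seq {set 'I_n}) (m : nat -> nat -> nat) : Prop :=
  [/\ m 0%N 0%N = n, m 1%N 0%N = size L, m 5 0%N = (size L * n)%N
    & forall j (e : 'I_n), (j < size L)%N ->
        m 2 (j * n + e)%N = nat_of_bool (e \in nth set0 L j)].

Lemma output_stored L s : stored L (nmem s) -> output n s = L.
Proof.
case=> _ sN _ sL; rewrite /output sN; apply: (@eq_from_nth _ set0).
  by rewrite size_map size_iota.
move=> j; rewrite size_map size_iota => jL.
rewrite (nth_map 0%N) ?size_iota // nth_iota // add0n.
by apply/setP => e; rewrite inE sL //; case: (e \in _).
Qed.

Definition solve_time (K : nat) : nat :=
  (n * (rcost (value_exp K K) + 3 + 13) + 10 + (TG + (n * (9 + 13) + 10 + (7 + 6))))%N.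

Lemma runs_solve K m s L :
  frame K.+3 m (rmem s) -> stored L (nmem s) ->
  runs (solve_cmd K) s (solve_time K) (fun s' =>
    frame K.+4 (rmem s) (rmem s') /\
    stored (rcons L (solution K m (rmem s K.+4))) (nmem s')).
Proof.
move=> fm [sn s1 s5 s2].
pose wt e := m 0%N e + \sum_(k < K) (m K.+3 k + rmem s K.+4 k) * m k.+1 e.
apply: runs_seq.
apply: (@runs_weaken _ _ (n * (rcost (value_exp K K) + 3 + 13) + 10) _ (fun s' =>
   [/\ frame K.+4 (rmem s) (rmem s'), counter_frame (nmem s) (nmem s')
    & forall e, (e < n)%N -> rmem s' K.+4.+1 e = wt e])) => //.
  apply: (runs_for_each (J := fun i s' =>
   [/\ frame K.+4 (rmem s) (rmem s'), counter_frame (nmem s) (nmem s')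
    & forall e, (e < i)%N -> rmem s' K.+4.+1 e = wt e])).
  - move=> i s' v [g1 g2 g3]; split=> //; exact: counter_frame_upd.
  - by move=> i s' [_ g2 _]; rewrite g2.
  - move=> i s' iN [g1 g2 g3] ci.
    apply: (@runs_weaken _ _ (2 + rcost (value_exp K K)).+1 _
      (fun s2 => [/\ frame K.+4 (rmem s) (rmem s2), counter_frame (nmem s) (nmem s2)
        & forall e, (e < i.+1)%N -> rmem s2 K.+4.+1 e = wt e] /\ nmem s2 4 0 = i)) => //; last lia.
    apply: runs_rset => /=; split=> //; split=> //; first exact: frame_upd.
    rewrite ci => e; rewrite ltnS leq_eqVlt => /orP[/eqP ->|ei]; last first.
      by rewrite /= upd_cell; [exact: g3|lia].
    rewrite upd_same reval_value ci /wt !g1 // !fm //; congr (_ + _).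
    apply: eq_bigr => k _; have kK := ltn_ord k.
    rewrite !g1 ?(fm K.+3) ?(fm k.+1) //; lia.
  - by [].
move=> s3 [g1 g2 g3]; apply/runs_seq/runs_greedy.
have -> : greedy (fun e : 'I_n => rmem s3 K.+4.+1 e) = solution K m (rmem s K.+4).
  by congr greedy; apply: boolp.funext => e; rewrite g3.
set x := solution _ _ _; set s4 := State _ _.
have h1 : rmem s4 = rmem s3 by [].
have h3 (e : 'I_n) : nmem s4 3 e = nat_of_bool (e \in x) by rewrite /= /write_set /= valK.
have h2 a i : a != 4%N -> a != 3 -> nmem s4 a i = nmem s a i.
  by move=> a4 a3; rewrite /= /write_set (negPf a3) g2.
clearbody s4; apply: runs_seq.
(* After [i] steps, exactly the first [i] cells of the new output block have been copied. *)
pose J i s' := [/\ rmem s' = rmem s4, forall a j, a != 4%N -> a != 2 -> nmem s' a j = nmem s4 a j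
  & forall p, nmem s' 2 p = if (size L * n <= p < size L * n + i)%N
      then nmem s4 3 (p - size L * n)%N else nmem s4 2 p].
apply: (@runs_weaken _ _ (n * (9 + 13) + 10) _ (J n)) => //.
  apply: (runs_for_each (J := J)).
  - by move=> i s' v [k1 k2 k3]; split=> // a j a4 a2; rewrite /= upd_array ?k2.
  - by move=> i s' [_ k2 _]; rewrite k2 // h2.
  - move=> i s' iN [k1 k2 k3] ci.
    apply: runs_nset => /=; rewrite ci k2 // h2 // s5; split=> //; split=> //.
      by move=> a j a4 a2; rewrite /= upd_array ?k2.
    move=> p; rewrite /upd /= k3.
    have [->|pn] := eqVneq p (size L * n + i)%N.
      by rewrite k2 // addKn leq_addr addnS ltnS leqnn.
    by congr (if _ then _ else _); lia.
  - by split=> // p; case: ifPn => //; lia.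
move=> s5' [k1 k2 k3]; apply/runs_seq/runs_nset/runs_nset => /=.
have e5 : nmem s5' 5 0 = (size L * n)%N by rewrite k2 // h2.
have e0 : nmem s5' 0 0 = n by rewrite k2 // h2.
have e1 : nmem s5' 1 0 = size L by rewrite k2 // h2.
split; first by rewrite k1 h1.
split; rewrite /upd /= ?size_rcons //.
- by rewrite e1 addn1.
- by rewrite e5 e0 mulSn addnC.
move=> j e; rewrite ltnS leq_eqVlt nth_rcons => /orP[/eqP ->|jL].
  rewrite ltnn eqxx k3 leq_addr ltn_add2l ltn_ord /= addKn; exact: h3.
(* Earlier blocks end before cell [size L * n] and are not overwritten. *)
rewrite jL k3 ifF ?h2 ?s2 //.
have := ltn_ord e; nia.
Qed.

(** The list produced by the nested loops, in program order; [r] holds the coordinates already fixed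
    by the outer loops. *)
Fixpoint grid_solutions (K : nat) (m : nat -> nat -> R) (D rho : R) (M p : nat)
    (r : nat -> R) : seq {set 'I_n} :=
  if p is k.+1 then
    flatten [seq grid_solutions K m D rho M k
                   (fun j => if j == k then D^-1 * rho ^+ i else r j) | i <- iota 0 M]
  else [:: solution K m r].

(** Coordinates below [p] are overwritten before use, so the stale values left there by earlier
    inner loops do not matter. *)
Lemma grid_solutions_ext K m D rho M p r r' :
  (forall k, (p <= k)%N -> r k = r' k) ->
  grid_solutions K m D rho M p r = grid_solutions K m D rho M p r'.
Proof.
elim: p r r' => [|p IHp] r r' rr' /=.
  by congr [:: solution K m _]; apply: boolp.funext => k; exact: rr'.
congr flatten; apply: eq_map => i; apply: IHp => k pk.
by case: eqVneq => // kp; apply: rr'; lia.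
Qed.

Lemma grid_solutionsP K m D rho M p r x :
  x \in grid_solutions K m D rho M p r ->
  exists idx : nat -> nat,
    x = solution K m (fun k => if (k < p)%N then D^-1 * rho ^+ idx k else r k).
Proof.
elim: p r => [|p IHp] r /=; first by rewrite inE => /eqP ->; exists id.
move=> /flattenP[_ /mapP[i _ ->]] /IHp[idx ->].
exists (fun k => if k == p then i else idx k); congr solution; apply: boolp.funext => k.
by rewrite [(k < p.+1)%N]ltnS [(k <= p)%N]leq_eqVlt; case: eqVneq => [->|] /=; rewrite ?ltnn.
Qed.

Lemma mem_grid_solutions K m D rho M p r (idx : nat -> nat) :
  (forall k, (idx k < M)%N) ->
  solution K m (fun k => if (k < p)%N then D^-1 * rho ^+ idx k else r k)
    \in grid_solutions K m D rho M p r.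
Proof.
move=> idxM; elim: p r => [|p IHp] r /=; first by rewrite inE.
apply/flattenP; eexists; first by apply: map_f; rewrite mem_iota /=; exact: (idxM p).
suff -> : (fun k => if (k < p.+1)%N then D^-1 * rho ^+ idx k else r k) =
  (fun k => if (k < p)%N then D^-1 * rho ^+ idx k
            else if k == p then D^-1 * rho ^+ idx p else r k) by exact: IHp.
apply: boolp.funext => k.
by rewrite [(k < p.+1)%N]ltnS [(k <= p)%N]leq_eqVlt; case: eqVneq => [->|] /=; rewrite ?ltnn.
Qed.

Fixpoint grid_time (K M p : nat) : nat :=
  if p is p'.+1 then (6 + (M * (8 + (grid_time K M p' + 7)) + 8))%N else solve_time K.

(** The two bounds on the grid say that the loop test succeeds for the first [M] points and fails at
    the next one, so each loop makes exactly [M] rounds. *)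
Lemma runs_grid K m D rho M p s L :
  m K.+2 1%N = D -> m K.+2 2 = rho ->
  (forall i, (i < M)%N -> D^-1 * rho ^+ i <= rho * D) -> rho * D < D^-1 * rho ^+ M ->
  frame K.+3 m (rmem s) -> stored L (nmem s) ->
  runs (grid_cmd K p) s (grid_time K M p) (fun s' =>
    [/\ frame K.+3 m (rmem s'), forall k, (p <= k)%N -> rmem s' K.+4 k = rmem s K.+4 k
      & stored (L ++ grid_solutions K m D rho M p (rmem s K.+4)) (nmem s')]).
Proof.
move=> mD mrho Ulo Uhi; elim: p s L => [|p IHp] s L fm sL.
  apply: runs_weaken (runs_solve fm sL) (leqnn _) _ => s' [f1 f2].
  rewrite cats1; split=> // [|k _]; last exact: f1.
  by apply: frame_trans fm f1.
pose r := rmem s K.+4.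
pose sols i := [seq grid_solutions K m D rho M p
                   (fun j => if j == p then D^-1 * rho ^+ i' else r j) | i' <- iota 0 i].
pose J i s' := [/\ frame K.+3 m (rmem s'), rmem s' K.+4 p = D^-1 * rho ^+ i,
  forall k, (p < k)%N -> rmem s' K.+4 k = r k & stored (L ++ flatten (sols i)) (nmem s')].
apply: (@runs_weaken _ _ _ _ (J M)) => [| |s' [j1 j2 j3 j4]]; last by split.
  apply: runs_seq; apply: runs_rset.
  apply: (@runs_while _ _ M (grid_time K M p + 7) J).
  - move=> i s1 iM [j1 j2 j3 j4]; split.
      by rewrite /= j2 !j1 // mD mrho Ulo.
    apply: runs_seq; apply: runs_weaken (IHp _ _ j1 j4) (leqnn _) _ => s2 [k1 k2 k3].
    apply: runs_rset; split.
    + exact: frame_upd.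
    + by rewrite /= upd_same k2 // j2 k1 // mrho exprSr mulrA.
    + by move=> k pk; rewrite /= upd_cell ?k2 ?j3 //; lia.
    + rewrite /sols -[i.+1]addn1 iotaD map_cat flatten_cat /= cats0 catA add0n.
      rewrite (@grid_solutions_ext _ _ _ _ _ _ _ (rmem s1 K.+4)) // => k pk.
      by case: eqVneq => [->//|kp]; rewrite j3 //; lia.
  - by move=> s1 [j1 j2 _ _]; rewrite /= j2 !j1 // mD mrho -ltNge.
  - split=> /=.
    + exact: frame_upd.
    + by rewrite upd_same fm // mD expr0 mulr1 div1r.
    + by move=> k pk; rewrite upd_cell //; lia.
    + by rewrite cats0.
by rewrite /=; lia.
Qed.
End Runs.

(** * The program on a given instance *)

Section Instance.
Variables (R : realType) (K n : nat) (I : param_instance K n) (eps : R).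
Let s0 : state R := init_state I eps.

Lemma init_acoef (e : 'I_n) : rmem s0 0 e = (acoef I e)%:R.
Proof. by rewrite /= valK. Qed.

Lemma init_bcoef (k : 'I_K) (e : 'I_n) : rmem s0 k.+1 e = (bcoef I k e)%:R.
Proof. by rewrite /= eqSS ltn_eqF // !valK. Qed.

Lemma init_eps : rmem s0 K.+1 0%N = eps.
Proof. by rewrite /= eqxx. Qed.

Lemma init_above a i : (K.+1 < a)%N -> rmem s0 a i = 0.
Proof.
move=> Ka /=; rewrite gtn_eqF //; case: insub => // e.
by case: a Ka => // a Ka; rewrite insubF //; lia.
Qed.

Definition total_weight : R :=
  \sum_(e < n) (1 + (acoef I e)%:R + \sum_(k < K) (bcoef I k e)%:R).

Lemma total_weight_ge (e : 'I_n) :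
  1 + (acoef I e)%:R + \sum_(k < K) (bcoef I k e)%:R <= total_weight.
Proof.
rewrite /total_weight (bigD1 e) //= lerDl; apply: sumr_ge0 => f _.
by rewrite !addr_ge0 // sumr_ge0.
Qed.

Lemma total_weight_ge_acoef (e : 'I_n) : 1 + (acoef I e)%:R <= total_weight.
Proof. by apply: le_trans (total_weight_ge e); rewrite lerDl sumr_ge0. Qed.

Lemma total_weight_ge_bcoef k (e : 'I_n) : (bcoef I k e)%:R <= total_weight.
Proof.
apply: le_trans (total_weight_ge e); rewrite (bigD1 k) //= addrCA lerDl.
by rewrite !addr_ge0 // sumr_ge0.
Qed.

Lemma total_weight_ge_size : n%:R <= total_weight.
Proof.
rewrite -[n in n%:R]card_ord -sumr_const; apply: ler_sum => e _.
by rewrite -addrA lerDl addr_ge0 // sumr_ge0.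
Qed.

Lemma total_weight_ge_sum :
  \sum_e ((acoef I e)%:R + \sum_k (bcoef I k e)%:R) <= total_weight.
Proof. by apply: ler_sum => e _; rewrite -addrA lerDr. Qed.

(** An element contributes 1 and [K + 1] components, each at most the maximum component, which is at
    least 1 because some [b_k] entry is nonzero. *)
Lemma total_weight_le : (0 < K)%N ->
  total_weight <= K.+2%:R * (n%:R * (max_component I)%:R).
Proof.
move=> K0.
have aC e : (acoef I e <= max_component I)%N.
  by rewrite leq_max (bigop.leq_bigmax e).
have bC k e : (bcoef I k e <= max_component I)%N.
  rewrite leq_max; apply/orP; right; apply: (bigop.bigmax_sup k) => //.
  exact: (bigop.leq_bigmax e).
have C1 : (0 < max_component I)%N.
  have [e be] := bcoef_neq0 I (Ordinal K0).
  by apply: leq_trans (bC (Ordinal K0) e); rewrite lt0n.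
rewrite mulrCA -[n%:R]/(n%:R) -{1}[n]card_ord mulr_natl -sumr_const; apply: ler_sum => e _.
rewrite -natr_sum -[1]/(1%:R) -!natrD -natrM ler_nat.
have : (\sum_(k < K) bcoef I k e <= \sum_(k < K) max_component I)%N by apply: leq_sum.
rewrite sum_nat_const card_ord => leK; rewrite !mulSn addnA; apply: leq_add leK; exact: leq_add C1 (aC e).
Qed.

(** The start value cannot survive: a threshold is at least [- a_e], whereas the total weight is at
    least [1 + a_e]. *)
Lemma is_max_threshold_is_lambda_min (m : nat -> nat -> R) :
  (0 < K)%N ->
  (forall k : 'I_K, is_max_threshold (rmem s0) K k n total_weight (m K.+3 k)) ->
  is_lambda_min I (fun k : 'I_K => m K.+3 k).
Proof.
move=> K0 H.
have thresholdE (k : 'I_K) (e : 'I_n) : threshold (rmem s0) K k e =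
    - ((acoef I e)%:R / (K%:R * (bcoef I k e)%:R)).
  by rewrite /threshold init_acoef init_bcoef.
split=> [k e be|k].
  by have [/(_ e (ltn_ord e)) + _] := H k; rewrite thresholdE init_bcoef ltr0n lt0n => /(_ be).
have [lo [vS|[e [en]]]] := H k; last first.
  rewrite (init_bcoef k (Ordinal en)) ltr0n lt0n (thresholdE k (Ordinal en)) => be vE.
  by exists (Ordinal en).
have [e be] := bcoef_neq0 I k.
have := lo e (ltn_ord e); rewrite init_bcoef ltr0n lt0n => /(_ be).
rewrite thresholdE vS lerN2 => le_S.
have aa : (acoef I e)%:R / (K%:R * (bcoef I k e)%:R) <= (acoef I e)%:R :> R.
  rewrite ler_pdivrMr ?mulr_gt0 ?ltr0n ?lt0n // -?lt0n //.
  by rewrite ler_peMr // -natrM ler1n muln_gt0 K0 lt0n.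
have := total_weight_ge_acoef e; lra.
Qed.

Lemma is_max_threshold_frame (m m' : nat -> nat -> R) (k N : nat) (S v : R) :
  (k < K)%N -> frame K.+1 m m' -> is_max_threshold m' K k N S v -> is_max_threshold m K k N S v.
Proof.
move=> kK fr; have kE : m' k.+1 = m k.+1 by apply: boolp.funext => e; rewrite fr // ltnS ltnW.
have thresholdE : threshold m' K k = threshold m K k.
  by apply: boolp.funext => e; rewrite /threshold kE fr.
by rewrite /is_max_threshold kE thresholdE.
Qed.

Variables (greedy : ('I_n -> R) -> {set 'I_n}) (TG : nat).

Definition approx_time (M : nat) : nat :=
  (total_time K n + ((rcost (power_exp (scalar_exp K 0) K.+2) + 30) +
   (lambda_min_time n K + grid_time n TG K M K)))%N.

(** That all outputs come from grid points will give independence; that every grid point is served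
    provides the solution chosen by [grid_approx]. *)
Lemma runs_approx (M : nat) :
  (0 < K)%N ->
  let D := 6 * K%:R * total_weight ^+ K.+2 / eps in
  let rho := 1 + eps / 2 in
  (forall i, (i < M)%N -> D^-1 * rho ^+ i <= rho * D) -> rho * D < D^-1 * rho ^+ M ->
  runs greedy TG (approx_cmd K) s0 (approx_time M) (fun s =>
    exists2 lm : 'I_K -> R, is_lambda_min I lm &
    let sol (idx : nat -> nat) := greedy (value I (fun k : 'I_K => lm k + D^-1 * rho ^+ idx k)) in
    (forall x, x \in output n s -> exists idx, x = sol idx) /\
    (forall idx, (forall k, (idx k < M)%N) -> sol idx \in output n s)).
Proof.
move=> K0 D rho Ulo Uhi.
apply: runs_seq; apply: runs_weaken (@runs_total _ _ _ _ K n s0 _ _) (leqnn _) _.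
- by [].
- by rewrite init_above.
move=> s1 [f1 c1]; rewrite (_ : \sum_(e < n) _ = total_weight); last first.
  apply: eq_bigr => e _; rewrite init_acoef; congr (_ + _); apply: eq_bigr => k _.
  by rewrite init_bcoef.
move=> e1; apply: runs_seq.
apply: runs_weaken (@runs_scalars _ _ _ _ K s1) (leqnn _) _ => s2 /=.
rewrite e1 f1 // init_eps -/D -/rho => -[f2 c2 t2 d2 r2].
apply: runs_seq.
apply: runs_weaken (@runs_lambda_min _ _ _ _ K n K s2 (leqnn _) _) (leqnn _) _.
  by rewrite c2 c1.
move=> s3 [f3 c3 p3].
have f03 : frame K.+1 (rmem s0) (rmem s3).
  by apply: frame_trans f3 => //; apply: frame_trans f2.
have sol0 : stored ([::] : seq {set 'I_n}) (nmem s3).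
  by split=> //; rewrite c3 // c2 c1.
apply: runs_weaken (@runs_grid _ _ _ _ K (rmem s3) D rho M K s3 [::] _ _ Ulo Uhi _ sol0) (leqnn _) _ => //.
- by rewrite f3.
- by rewrite f3.
move=> s4 [_ _ /output_stored ->] /=.
exists (fun k : 'I_K => rmem s3 K.+3 k).
  apply: is_max_threshold_is_lambda_min => // k; have := p3 k (ltn_ord k).
  rewrite t2; apply: is_max_threshold_frame => //.
  exact: frame_trans f1 f2.
have solE (idx : nat -> nat) : solution greedy K (rmem s3)
    (fun k => if (k < K)%N then D^-1 * rho ^+ idx k else rmem s3 K.+4 k) =
    greedy (value I (fun k : 'I_K => rmem s3 K.+3 k + D^-1 * rho ^+ idx k)).
  congr greedy; apply: boolp.funext => e; rewrite f03 // init_acoef /value; congr (_ + _).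
  apply: eq_bigr => k _; have kK := ltn_ord k.
  rewrite kK (f03 k.+1) ?init_bcoef //; exact: ltnW.
split=> [x /grid_solutionsP[idx ->]|idx idxM]; first by exists idx; rewrite solE.
by rewrite -solE; exact: mem_grid_solutions.
Qed.
End Instance.

(** * Running time *)

(** The inequality [ln (1 + y) <= y] at [y = x^-1 - 1]. *)
Lemma ln_ge_one_sub_inv (R : realType) (x : R) : 0 < x -> 1 - x^-1 <= ln x.
Proof.
move=> x0; have xV0 : 0 < x^-1 by rewrite invr_gt0.
have := @le_ln1Dx R (x^-1 - 1); rewrite subrKC lnV ?posrE // => H.
have : - ln x <= x^-1 - 1 by apply: H; lra.
lra.
Qed.

(** [M] is the least index whose grid point exceeds [rho * D]; that index [M - 1] fails, on taking
    logarithms, bounds [M]. *)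
Lemma ex_grid_size (R : realType) (D rho : R) : 1 <= D -> 1 < rho ->
  exists M : nat,
    [/\ forall i, (i < M)%N -> D^-1 * rho ^+ i <= rho * D, rho * D < D^-1 * rho ^+ M
      & M%:R * ln rho <= 2 * (ln rho + ln D)].
Proof.
move=> D1 rho1; have D0 : 0 < D by lra.
have rho0 : 0 < rho by lra.
have lr0 : 0 < ln rho by exact: ln_gt0.
have lD0 : 0 <= ln D by exact: ln_ge0.
have gridE i : (rho * D < D^-1 * rho ^+ i) = (ln rho + 2 * ln D < i%:R * ln rho).
  rewrite ltr_pdivlMl // -ltr_ln ?posrE ?mulr_gt0 ?exprn_gt0 // !lnM ?posrE ?mulr_gt0 // lnXn // mulr_natl.
  by congr (_ < _); ring.
have ex : exists M : nat, rho * D < D^-1 * rho ^+ M.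
  exists (Num.bound ((ln rho + 2 * ln D) / ln rho)).
  rewrite gridE -ltr_pdivrMr //; apply: archi_boundP.
  by rewrite divr_ge0 ?(ltW lr0) //; lra.
case: (ex_minnP ex) => M HM Mmin; exists M; split=> //.
  by move=> i iM; rewrite leNgt; apply/negP => /Mmin; rewrite leqNgt iM.
case: M HM Mmin => [|M] HM Mmin; first by rewrite mul0r; lra.
have : ~~ (rho * D < D^-1 * rho ^+ M) by apply/negP => /Mmin; rewrite ltnn.
rewrite gridE -leNgt -natr1 => h; lra.
Qed.

(** The factor 16 absorbs the overhead of a loop, since the bound on the inner time is at least
    1. *)
Lemma grid_time_le (n TG K M p : nat) :
  (grid_time n TG K M p <= (solve_time n TG K).+1 * (16 * M.+1) ^ p)%N.
Proof.
elim: p => [|p IHp]; first by rewrite expn0 muln1 /=; lia.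
rewrite expnS mulnCA /=.
have B1 : (0 < (solve_time n TG K).+1 * (16 * M.+1) ^ p)%N by rewrite muln_gt0 expn_gt0.
move: IHp B1; set B := ((_).+1 * _)%N; nia.
Qed.

(** The summands bound, in order, the total, the scalars, [lambda_min] and the grid; additive
    constants are absorbed by [1 <= n] and linear terms by [n <= TG]. *)
Definition time_constant (K : nat) : nat :=
  (rcost (component_sum_exp K) + 28 + (rcost (power_exp (scalar_exp K 0) K.+2) + 30)
   + (K * 66 + 1) + (rcost (value_exp K K) + 74) * 16 ^ K)%N.

Lemma approx_time_le (n TG K M : nat) : (0 < n)%N -> (n <= TG)%N ->
  (approx_time K n TG M <= time_constant K * (TG * M.+1 ^ K))%N.
Proof.
move=> n0 nT; have MK : (0 < M.+1 ^ K)%N by rewrite expn_gt0.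
have TMK : (TG <= TG * M.+1 ^ K)%N by rewrite leq_pmulr.
have H1 : (total_time K n <= (rcost (component_sum_exp K) + 28) * TG)%N.
  by rewrite /total_time; nia.
have H2 : (lambda_min_time n K <= (K * 66 + 1) * TG)%N.
  by rewrite /lambda_min_time; nia.
have H3 : ((solve_time n TG K).+1 <= (rcost (value_exp K K) + 74) * TG)%N.
  by rewrite /solve_time; nia.
have H4 := leq_trans (grid_time_le n TG K M K) (leq_mul H3 (leqnn _)).
rewrite expnMn in H4.
rewrite /approx_time /time_constant.
have X0 : (0 < TG * M.+1 ^ K)%N by apply: leq_trans TMK; exact: leq_trans nT.
move: H1 H2 H4 TMK X0; set G := grid_time _ _ _ _ _.
have E w : (w * TG * (16 ^ K * M.+1 ^ K) = w * 16 ^ K * (TG * M.+1 ^ K))%N.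
  by rewrite -!mulnA; congr (w * _)%N; rewrite mulnCA.
rewrite E.
move: (rcost _ + 28)%N (rcost _ + 30)%N (K * 66 + 1)%N (_ * 16 ^ K)%N (TG * _)%N.
move=> a b d w X H1 H2 H4 TX X0.
have Ha : (a * TG <= a * X)%N by rewrite leq_mul2l TX orbT.
have Hd : (d * TG <= d * X)%N by rewrite leq_mul2l TX orbT.
have Hb : (b <= b * X)%N by rewrite leq_pmulr.
rewrite !mulnDl; lia.
Qed.

Definition size_constant (R : realType) (K : nat) : R :=
  3 + 8 * (ln (6 * K%:R) + K.+2%:R * ln K.+2%:R + K.+2%:R * ln 2).

(** The number of points is of order [ln D / eps], and [ln D] is bounded by a constant depending on
    [K] plus a multiple of [ln eps^-1 + ln N]. Constants are absorbed because [eps <= 1 / 2] makes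
    [ln eps^-1] at least [ln 2]. *)
Lemma grid_size_le (R : realType) (K : nat) (eps S N D : R) (M : nat) :
  (0 < K)%N -> 0 < eps -> eps <= 1 / 2 -> 1 <= S -> 1 <= N -> S <= K.+2%:R * N ->
  D = 6 * K%:R * S ^+ K.+2 / eps ->
  M%:R * ln (1 + eps / 2) <= 2 * (ln (1 + eps / 2) + ln D) ->
  M.+1%:R <= size_constant R K * (eps^-1 * log2 eps^-1 + eps^-1 * log2 N).
Proof.
move=> K0 eps0 eps1 S1 N1 SN DE; set rho := 1 + eps / 2 => HM.
have S0 : 0 < S by lra. have N0 : 0 < N by lra.
have KR0 : 0 < K%:R :> R by rewrite ltr0n.
have K1 : 1 <= K%:R :> R by rewrite ler1n.
(* Here [1 - rho^-1 = (eps / 2) / rho], and [rho <= 2]. *)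
have lr : eps / 4 <= ln rho.
  apply: le_trans (ln_ge_one_sub_inv _); last by rewrite /rho; lra.
  rewrite lerBrDr addrC -lerBrDr -(ler_pM2l (_ : 0 < rho)); last by rewrite /rho; lra.
  by rewrite mulfV ?gt_eqF /rho; nra.
have l2 : 0 < ln 2 :> R by apply: ln_gt0; lra.
have lN : 0 <= ln N by exact: ln_ge0.
have le : ln 2 <= ln eps^-1.
  have h : 2 <= eps^-1 by rewrite -[eps^-1]div1r ler_pdivlMr //; lra.
  by rewrite ler_ln ?posrE ?invr_gt0.
have lS : ln S <= ln K.+2%:R + ln N.
  rewrite -lnM ?posrE ?ltr0n //; rewrite ler_ln ?posrE // mulr_gt0 // ltr0n.
have lD : ln D = ln (6 * K%:R) + K.+2%:R * ln S + ln eps^-1.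
  have p1 : 6 * K%:R \is @Num.pos R by rewrite posrE mulr_gt0.
  have p2 : S ^+ K.+2 \is @Num.pos R by rewrite posrE exprn_gt0.
  have p3 : eps^-1 \is @Num.pos R by rewrite posrE invr_gt0.
  rewrite DE; have -> : ln (6 * K%:R * S ^+ K.+2 / eps) =
      ln (6 * K%:R * S ^+ K.+2) + ln eps^-1 by exact: (lnM (rpredM p1 p2) p3).
  have -> : ln (6 * K%:R * S ^+ K.+2) = ln (6 * K%:R) + ln (S ^+ K.+2) := lnM p1 p2.
  by rewrite lnXn // -[ln S *+ _]mulr_natl.
pose Y := ln eps^-1 + ln N; pose a : R := ln (6 * K%:R) + K.+2%:R * ln K.+2%:R.
have a0 : 0 <= a.
  have lK : 0 <= ln (K.+2%:R : R) by rewrite ln_ge0 // ler1n.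
  by rewrite addr_ge0 ?mulr_ge0 // ln_ge0 //; lra.
have YE : eps^-1 * log2 eps^-1 + eps^-1 * log2 N = Y / (eps * ln 2).
  rewrite /log2 /Y; field; rewrite !gt_eqF //.
have Y2 : ln 2 <= Y by rewrite /Y; lra.
have DY : ln D <= a + K.+2%:R * Y.
  have K2 : 1 <= K.+2%:R :> R by rewrite ler1n.
  rewrite lD /a /Y; nra.
have lr0 : 0 < ln rho by apply: lt_le_trans lr; lra.
have ME : M%:R <= 2 + 8 * (a + K.+2%:R * Y) / eps.
  have -> : 2 + 8 * (a + K.+2%:R * Y) / eps = 2 + 2 * (a + K.+2%:R * Y) / (eps / 4).
    by field; rewrite gt_eqF.
  have aY : 0 <= a + K.+2%:R * Y by rewrite addr_ge0 // mulr_ge0 //; lra.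
  apply: (@le_trans _ _ (2 + 2 * (a + K.+2%:R * Y) / ln rho)).
    rewrite -(ler_pM2r lr0) mulrDl mulfVK ?gt_eqF //; lra.
  rewrite lerD2l ler_wpM2l ?mulr_ge0 // lef_pV2 ?posrE //; lra.
rewrite YE mulrA ler_pdivlMr ?mulr_gt0 // -natr1.
have : (M%:R - 2) * eps <= 8 * (a + K.+2%:R * Y).
  by rewrite -ler_pdivlMr //; lra.
rewrite /size_constant -/a => h.
(* Passing from [M - 2] to [M + 1] adds [3 * eps <= 3], the 3 in [size_constant]. *)
have h1 : (M%:R + 1) * eps <= 8 * (a + K.+2%:R * Y) + 3 by nra.
apply: (@le_trans _ _ ((8 * (a + K.+2%:R * Y) + 3) * ln 2)).
  by rewrite mulrA ler_pM2r.
have -> : (3 + 8 * (a + K.+2%:R * ln 2)) * Y =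
  3 * Y + 8 * a * Y + 8 * K.+2%:R * Y * ln 2 by ring.
have : a * ln 2 <= a * Y by rewrite ler_wpM2l.
lra.
Qed.

(** * Approximation guarantee and running time combined *)

Theorem mainTheorem5 (R : realType) (K : nat) (hK : (1 <= K)%N) :
  exists (P : cmd) (c eps0 : R), 0 < c /\ 0 < eps0 /\
    forall (n : nat) (I : param_instance K n)
           (greedy : ('I_n -> R) -> {set 'I_n}) (TGreedy : nat),
      (forall lambda : 'I_K -> R, in_Lambda I lambda ->
         greedy_output (system I) (value I lambda) (greedy (value I lambda))) ->
      (n <= TGreedy)%N ->
      forall eps : R, 0 < eps -> eps < 1 ->
        exists (s : state R) (t : nat),
          [/\ exec greedy TGreedy P (init_state I eps) s t,
              approximation_set I ((1 + eps) * rank_quotient R (system I))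
                (output n s)
            & eps <= eps0 ->
              t%:R <= c * (TGreedy%:R *
                (eps^-1 * log2 eps^-1
                 + eps^-1 * log2 (n%:R * (max_component I)%:R)) ^+ K)].
Proof.
have l2 : 0 < ln 2 :> R by apply: ln_gt0; lra.
have KR1 : 1 <= K%:R :> R by rewrite ler1n.
have sc0 : 0 < size_constant R K.
  have lK : 0 <= ln (K.+2%:R : R) by rewrite ln_ge0 // ler1n.
  have l6 : 0 <= ln (6 * K%:R : R) by rewrite ln_ge0 //; lra.
  have k1 : 0 <= K.+2%:R * ln (K.+2%:R : R) by rewrite mulr_ge0.
  have k2 : 0 <= K.+2%:R * ln (2 : R) by rewrite mulr_ge0 // ltW.
  by rewrite /size_constant; lra.
(* The threshold [1 / 2] restricts only the time bound; the approximation guarantee is shown for all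
   [eps < 1]. *)
exists (approx_cmd K), ((time_constant K)%:R * size_constant R K ^+ K), (1 / 2).
split; first by rewrite mulr_gt0 ?exprn_gt0 // ltr0n /time_constant; lia.
split=> [|n I greedy TG grP nT eps eps0 eps1]; first lra.
have [e0 _] := indep_nontrivial_ex (system I).
have n0 : (0 < n)%N by apply: leq_ltn_trans (ltn_ord e0).
set S := total_weight R I.
have nS : n%:R <= S := total_weight_ge_size R I.
have n1 : 1 <= n%:R :> R by rewrite ler1n.
have S1 : 1 <= S by lra.
pose D := 6 * K%:R * S ^+ K.+2 / eps; pose rho := 1 + eps / 2.
have D1 : 1 <= D.
  rewrite ler_pdivlMr // mul1r; apply: (@le_trans _ _ (6 * K%:R)); first lra.
  by rewrite ler_peMr ?exprn_ege1 //; lra.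
have rho1 : 1 < rho by rewrite /rho; lra.
have [M [Mlo Mhi Mle]] := ex_grid_size D1 rho1.
have [s [t [ex tM [lm lmP [out_sol sol_out]]]]] :=
  runs_approx greedy TG hK Mlo Mhi.
(* Nonnegative shifts of [lm] stay in the parameter domain, so the greedy hypothesis applies at
   every grid point. *)
have in_L (mu : 'I_K -> R) : (forall k, 0 <= mu k) -> in_Lambda I (fun k => lm k + mu k).
  move=> mu0; apply/in_LambdaP => k e be; apply: le_trans (lmP.1 k e be) _.
  by rewrite lerDl.
have grid0 (idx : nat -> nat) (k : 'I_K) : 0 <= D^-1 * rho ^+ idx k.
  by rewrite mulr_ge0 ?invr_ge0 ?exprn_ge0 //; lra.
exists s, t; split=> //.
  split=> [|x /out_sol[idx ->]|lambda lamP].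
  - by have := rank_quotient_ge1 R (system I); nra.
  - exact: greedy_output_indep (grP _ (in_L _ (grid0 idx))).
  have [idx idxM H] := grid_approx hK grP lmP nS (total_weight_ge_bcoef R I)
    (total_weight_ge_sum R I) eps0 eps1 Mhi lamP.
  by eexists; [exact: sol_out idxM|exact: H].
move=> eps2; apply: (@le_trans _ _ (time_constant K * (TG * M.+1 ^ K))%:R).
  by rewrite ler_nat (leq_trans tM) // approx_time_le.
rewrite !natrM natrX -mulrA; apply: ler_wpM2l => //.
have C1 : (0 < max_component I)%N.
  have [e be] := bcoef_neq0 I (Ordinal hK).
  rewrite leq_max; apply/orP; right; apply: (bigop.bigmax_sup (Ordinal hK)) => //.
  by apply: (bigop.bigmax_sup e); rewrite ?lt0n.
have N1 : 1 <= n%:R * (max_component I)%:R :> R by rewrite -natrM ler1n muln_gt0 n0.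
have Msize : M.+1%:R <= size_constant R K * (eps^-1 * log2 eps^-1
    + eps^-1 * log2 (n%:R * (max_component I)%:R)).
  exact: (grid_size_le hK eps0 eps2 S1 N1 (total_weight_le R I hK) erefl Mle).
rewrite mulrCA -exprMn; apply: ler_wpM2l => //; apply: lerXn2r (Msize); rewrite nnegrE //.
exact: le_trans Msize.
Qed.
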